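(* Let $d\ge 1$, $b\ge 2$ be integers and let $\{P_m(\mathbf t):\mathbf t\in[0,1]^d\}_{m\ge 0}$ be a sequence of independent stochastic processes with $P_m(\mathbf t)\ge 0$ and $\mathbb E[P_m(\mathbf t)]= 1$ for all $m,\mathbf t$. Suppose Assumption 1 (sub-exponential partition and independence) and Assumption 2 (uniform Mandelbrot–Kahane $L^p$-condition) of the context hold, the latter with exponent $p_0\in(1,2]$. Then for every $1<p\le p_0$, $$\sup_{m\ge 0}\mathbb E\big[\big(\mu_m([0,1]^d)\big)^p\big]<\infty,$$ and consequently the multiplicative chaos measure $\mu_\infty$ is non-degenerate, i.e. $\mathbb P(\mu_\infty\neq 0)>0$.
   Context: Processes are jointly measurable. For $m\ge0$ let $\mu_m(d\mathbf t)=\big[\prod_{j=0}^m P_j(\mathbf t)\big]d\mathbf t$ on $[0,1]^d$. Almost surely $\mu_m$ converges weakly as $m\to\infty$ to a random finite measure $\mu_\infty$ on $[0,1]^d$ (Kahane's $T$-martingale theory), called the multiplicative chaos measure. $b$-adic cubes: $\mathscr D_m^b$ is the family of cubes $\mathbf I=\prod_{\beta=1}^d[\frac{h_\beta-1}{b^m},\frac{h_\beta}{b^m})$ with $h_\beta\in\{1,\dots,b^m\}$. For a process $P$ and a cube $\mathbf I$, $P^{\mathbf I}=\{P(\mathbf t):\mathbf t\in\mathbf I\}$ is the restricted process. Assumption 1. There is an integer $k_0\ge 0$ with $P_k\not\equiv 1$ for every $k>k_0$, and there are positive integers $(N_m)_{m\ge0}$ with $N_m=o(b^{m\varepsilon})$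 as $m\to\infty$ for every $\varepsilon>0$, and for each $m\ge 0$ a partition $\mathscr D_m^b=\bigsqcup_{i=1}^{N_m}\mathscr D_{m,i}^b$, such that for all $k>k_0$ and $1\le i\le N_{k-1}$ the processes $\{P_k^{\mathbf I}:\mathbf I\in\mathscr D_{k-1,i}^b\}$ are jointly independent. Assumption 2. There is $p_0\in(1,2]$ such that $\sup_{\mathbf t\in[0,1)^d}\mathbb E[P_j(\mathbf t)^{p_0}]<\infty$ for all $j\ge0$ and $\limsup_{j\to\infty}\sup_{\mathbf t\in[0,1)^d}\mathbb E[P_j(\mathbf t)^{p_0}]<b^{d(p_0-1)}$. *)

(* Defs.v *)
From HB Require Import structures.
From mathcomp Require Import all_boot all_order all_algebra.
From mathcomp Require Import finmap.
From mathcomp Require Import all_classical all_reals all_analysis.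

Set Implicit Arguments.
Unset Strict Implicit.
Unset Printing Implicit Defensive.

Import Order.TTheory GRing.Theory Num.Theory.
Import numFieldNormedType.Exports.

Local Open Scope classical_set_scope.
Local Open Scope ring_scope.

(* R^d is [d.-tuple R] with its product sigma-algebra. *)

Section lebesgue_tuple.
Context {R : realType}.

Definition tuple_cons n (z : measurableTypeR R * n.-tuple R) : n.+1.-tuple R :=
  [tuple of z.1 :: z.2].

Lemma measurable_tuple_cons n : measurable_fun setT (@tuple_cons n).
Proof. exact: measurable_cons. Qed.

Section cons_measure.
Variables (n : nat) (m : {sigma_finite_measure set (n.-tuple R) -> \bar R}).

Definition cons_measure : set (n.+1.-tuple R) -> \bar R :=
  pushforward (@lebesgue_measure R \x m)%E (@tuple_cons n).

Let cons_measure0 : cons_measure set0 = 0%E.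
Proof. by rewrite /cons_measure /pushforward preimage_set0 measure0. Qed.

Let cons_measure_ge0 A : (0 <= cons_measure A)%E.
Proof. by rewrite /cons_measure /pushforward; exact: measure_ge0. Qed.

Let cons_measure_sigma_additive : semi_sigma_additive cons_measure.
Proof.
move=> F mF tF mUF.
apply: (@measure_semi_sigma_additive _ _ _ (pushforward _ _)) => //.
exact: measurable_tuple_cons.
Qed.

HB.instance Definition _ := isMeasure.Build _ _ _ cons_measure
  cons_measure0 cons_measure_ge0 cons_measure_sigma_additive.

Let cons_measure_sigma_finite : sigma_finite setT cons_measure.
Proof.
have [F FT mF] : sigma_finite setT (@lebesgue_measure R \x m)%E.
  have /sigma_finiteP[F [FT ndF Foo]] := sigma_finiteT (@lebesgue_measure R).
  have /sigma_finiteP[G [GT ndG Goo]] := sigma_finiteT m.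
  exists (fun k => F k `*` G k).
    rewrite -setXTT FT GT predeqE => -[x y]; split.
      move=> [/= [j _ Fjx] [k _ Gky]]; exists (maxn j k) => //; split.
        by move: x Fjx; exact/subsetPset/ndF/leq_maxl.
      by move: y Gky; exact/subsetPset/ndG/leq_maxr.
    by move=> [k _ []/= ? ?]; split; exists k.
  move=> k; have [? ?] := Foo k; have [? ?] := Goo k.
  split; first exact: measurableX.
  by rewrite product_measure1E// lte_mul_pinfty// ge0_fin_numE.
pose h (t : n.+1.-tuple R) : measurableTypeR R * n.-tuple R :=
  (thead t, [tuple of behead t]).
have hK : cancel (@tuple_cons n) h.
  by move=> [x t]; congr pair; apply: val_inj.
have mh : measurable_fun setT h.
  apply: measurable_fun_pair; first exact: measurable_tnth.
  apply/measurable_fun_tnthP => i.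
  rewrite (_ : _ \o _ = (fun t => tnth t (lift ord0 i))).
    exact: measurable_tnth.
  by apply/funext => t /=; rewrite [in RHS](tuple_eta t) tnthS.
exists (fun i => h @^-1` F i).
  by rewrite -preimage_bigcup -FT preimage_setT.
move=> i; split.
  by rewrite -[X in measurable X]setTI; apply: mh => //; exact: (mF i).1.
rewrite /cons_measure /pushforward -comp_preimage.
rewrite (_ : h \o _ = idfun) ?preimage_id; first exact: (mF i).2.
by apply/funext => z; exact: hK.
Qed.

HB.instance Definition _ := Measure_isSigmaFinite.Build _ _ _ cons_measure
  cons_measure_sigma_finite.

End cons_measure.

Fixpoint lebesgue_tuple d : {sigma_finite_measure set (d.-tuple R) -> \bar R} :=
  match d with
  | 0%N => dirac ([tuple] : 0.-tuple R)
  | n.+1 => cons_measure (lebesgue_tuple n)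
  end.

Lemma lebesgue_tuple_box d (A : 'I_d -> set R) :
  (forall i, measurable (A i)) ->
  lebesgue_tuple d [set t | forall i, A i (tnth t i)] =
  (\prod_(i < d) lebesgue_measure (A i))%E.
Proof.
elim: d A => [|d IH] A mA.
  by rewrite big_ord0 /= /dirac indicE mem_set// => -[].
rewrite big_ord_recl -IH// /= /cons_measure /pushforward.
rewrite -product_measure1E//; last 2 first.
- exact: mA.
- rewrite (_ : mkset _ = \bigcap_(i in [set: 'I_d])
    ((fun t : d.-tuple R => tnth t i) @^-1` A (lift ord0 i))); last first.
    by apply/seteqP; split => [t At i _|t At i]; [exact: At|exact: (At i)].
  apply: fin_bigcap_measurable => // i _.
  by rewrite -[X in measurable X]setTI; exact: measurable_tnth.
congr product_measure1; apply/seteqP; split => -[x t] /=.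
  move=> At; split; first exact: (At ord0).
  by move=> i; have := At (lift ord0 i); rewrite tnthS.
move=> [Ax At] i; case: (unliftP ord0 i) => [j|] ->; last exact: Ax.
by rewrite tnthS; exact: At.
Qed.

End lebesgue_tuple.

Section cubes.
Context {R : realType}.

Definition unit_cube d : set (d.-tuple R) :=
  [set t | forall i, 0 <= tnth t i <= 1].
Arguments unit_cube : clear implicits.

Definition unit_cube_ho d : set (d.-tuple R) :=
  [set t | forall i, 0 <= tnth t i < 1].
Arguments unit_cube_ho : clear implicits.

(* [h i] runs over {0, ..., b^m - 1}, so it stands for h_i - 1 when the indices
   are counted from 1. *)
Definition badic_cube d b m (h : 'I_d -> 'I_(b ^ m)) : set (d.-tuple R) :=
  [set t | forall i,
    (h i)%:R / b%:R ^+ m <= tnth t i < (h i).+1%:R / b%:R ^+ m].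

Definition badic_cubes d b m : set (set (d.-tuple R)) :=
  range (@badic_cube d b m).

(* Tuples carry no topology in the library: continuity on [0,1]^d is read on
   the row vectors 'rV[R]_d. *)
Definition unit_cube_continuous d (f : d.-tuple R -> R) : Prop :=
  {within [set v : 'rV[R]_d | forall i, 0 <= v ord0 i <= 1],
    continuous (fun v : 'rV[R]_d => f [tuple v ord0 i | i < d])}.

Definition weak_cvg d (nu : nat -> set (d.-tuple R) -> \bar R)
    (mu : set (d.-tuple R) -> \bar R) : Prop :=
  forall f : d.-tuple R -> R, unit_cube_continuous f ->
    (\int[nu m]_(t in unit_cube d) (f t)%:E)%E @[m --> \oo] -->
    (\int[mu]_(t in unit_cube d) (f t)%:E)%E.

End cubes.
Arguments unit_cube {R} d.
Arguments unit_cube_ho {R} d.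
Arguments badic_cubes {R} d b m.

Section independence.
Context d (Omega : measurableType d) (R : realType) (P : probability Omega R).

(* Mutual independence of the set systems [F i], i in [A]: the product rule for
   every finite subfamily. *)
Definition mutually_independent (I : choiceType) (A : set I)
    (F : I -> set_system Omega) : Prop :=
  forall J : {fset I}, [set` J] `<=` A ->
  forall E : I -> set Omega, (forall i, i \in J -> F i (E i)) ->
    P (\bigcap_(i in [set` J]) E i) = (\prod_(i <- J) P (E i))%E.

(* sigma(Y t : t in S) *)
Definition process_sigma (T : Type) (Y : Omega -> T -> R) (S : set T) :
    set_system Omega :=
  <<s \bigcup_(t in S) preimage_set_system setT (Y ^~ t) measurable >>.

End independence.

Section chaos.
Context dO (Omega : measurableType dO) (R : realType) (P : probability Omega R).
Context (d : nat).

(* A process indexed by [0,1]^d; its values off [unit_cube d] are irrelevant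
   and never used. *)
Implicit Types (Y : Omega -> d.-tuple R -> R).
Implicit Types (X : nat -> Omega -> d.-tuple R -> R).

Definition jointly_measurable Y : Prop :=
  measurable_fun ([set: Omega] `*` unit_cube d) (fun z => Y z.1 z.2).

(* The measure with density prod_(j <= m) P_j on [0,1]^d, as a set function; it
   is a measure for every [w] once the processes are nonnegative and jointly
   measurable. *)
Definition chaos X (m : nat) (w : Omega) : set (d.-tuple R) -> \bar R :=
  fun A => (\int[lebesgue_tuple d]_(t in A `&` unit_cube d)
              (\prod_(j < m.+1) X j w t)%:E)%E.

Definition independent_processes X : Prop :=
  mutually_independent P [set: nat]
    (fun m => process_sigma (X m) (unit_cube d)).

(* "P_k is not identically 1" is read pointwise, which is the weakest reading.
   The blocks [D m i] of a partition may be empty. *)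
Definition assumption1 (b : nat) X : Prop :=
  exists k0 : nat,
    (forall k, (k0 < k)%N -> ~ (forall w t, unit_cube d t -> X k w t = 1)) /\
  exists N : nat -> nat,
    [/\ forall m, (0 < N m)%N,
        forall eps : R, 0 < eps ->
          (fun m => (N m)%:R : R^o) =o_\oo
          (fun m => b%:R `^ (m%:R * eps) : R^o) &
        exists D : forall m, 'I_(N m) -> set (set (d.-tuple R)),
          (forall m, \bigcup_i D m i = badic_cubes d b m /\
                     trivIset setT (D m)) /\
          (forall k, (k0 < k)%N -> forall i : 'I_(N k.-1),
             mutually_independent P (D k.-1 i) (process_sigma (X k)))].

Definition sup_moment X (q : R) (j : nat) : \bar R :=
  ereal_sup [set 'E_P[(fun w => X j w t `^ q)%R]%E | t in unit_cube_ho d].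

Definition assumption2 (b : nat) X (p0 : R) : Prop :=
  [/\ 1 < p0 <= 2,
      forall j, (sup_moment X p0 j < +oo)%E &
      (limn_esup (sup_moment X p0) < (b%:R `^ (d%:R * (p0 - 1)))%:E)%E].

(* A version of mu_oo: a random finite measure on [0,1]^d (a measurable family of measures on R^d
   carried by the cube) which is almost surely the weak limit of the
   [chaos X m]. *)
Definition chaos_limit X (mu : R.-ker Omega ~> d.-tuple R) : Prop :=
  [/\ forall w, (mu w [set: d.-tuple R] < +oo)%E,
      forall w, mu w (~` unit_cube d) = 0%E &
      {ae P, forall w, weak_cvg (fun m => chaos X m w) (mu w)}].

End chaos.

(* Main.v *)
(* The p0-th moments of the total masses are bounded through a discrete
   model. If [M] is the total mass at stage [m] and [A] is [min(M, K)], then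
   Fubini and Young's inequality show that, up to an arbitrarily small
   error, E[A^p0] is at most E[B^p0] for some average [B] of the density
   over one well-chosen point in each [b]-adic cube of level [m]; this
   avoids comparing the integral of a process with the sigma-algebra that
   the process generates. For such finite averages the masses at successive
   stages form a martingale, whose increment at stage [k] splits along the
   partition of level [k - 1] into blocks of independent centered terms. The
   von Bahr--Esseen inequality bounds the p0-th moment of this increment by
   a constant times [N_(k-1)^(p0-1) b^(-d(k-1)(p0-1)) prod_(j <= k) sup
   E[P_j^p0]], which is summable. Since all masses have mean 1, a bounded
   p0-th moment prevents them from tending to 0 almost surely. *)
From HB Require Import structures.
Require Import Defs.
From mathcomp Require Import all_boot all_order all_algebra.
From mathcomp Require Import finmap ring lra.
From mathcomp Require Import all_classical all_reals all_analysis.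
From mathcomp Require Import measurable_realfun.

Set Implicit Arguments.
Unset Strict Implicit.
Unset Printing Implicit Defensive.

Import Order.TTheory GRing.Theory Num.Theory.
Import numFieldNormedType.Exports.

Local Open Scope classical_set_scope.
Local Open Scope ring_scope.

(** * Elementary inequalities for real powers *)

Section power_inequalities.
Context {R : realType}.
Implicit Types (p q x y : R).

(** No conditional expectation is formed. A martingale difference Z enters only through
    E[sgn(S) |S|^(p-1) Z] = 0, the derivative of |S|^p tested against Z; this comes from a product
    rule for independent variables, extended from pi-systems. The bound p <= 2 makes that derivative
    Hoelder continuous of order p - 1 <= 1, so that the error of the linear approximation is at most
    a multiple of |Z|^p. Truncating at K makes E[A^p] finite, so that the multiple of it produced by
    Young's inequality can be absorbed. The sample points depend on m, K and the error, so the
    discrete bound must be uniform over all choices of points; in exchange the points are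
    deterministic, and the value of the process at a point of a cube is measurable for the
    sigma-algebra of that cube by construction. Cubes of distinct blocks may be dependent, and so
    may points inside one cube: in both places only Jensen's inequality is used. The first use costs
    N^(p-1); the second gains the factor b^(-d(k-1)(p-1)) that has to beat the moments. *)

Lemma young_powR p x y : 1 < p -> 0 <= x -> 0 <= y ->
  p * (x `^ (p - 1) * y) <= (p - 1) * x `^ p + y `^ p.
Proof.
move=> p1 x0 y0; have p0 : 0 < p by lra.
have pB0 : 0 < p - 1 by lra.
have := @conjugate_powR R (x `^ (p - 1)) y (p / (p - 1)) p.
rewrite powR_ge0 y0 divr_gt0// => /(_ erefl erefl erefl p0).
rewrite -powRrM (_ : (p - 1) * (p / (p - 1)) = p); last by field; lra.
move=> H; have {H} : x `^ (p - 1) * y <= x `^ p / (p / (p - 1)) + y `^ p / p.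
  by apply: H; field; lra.
rewrite -(ler_pM2l p0) => /le_trans; apply.
by rewrite le_eqVlt; apply/orP; left; apply/eqP; field; lra.
Qed.

(** Young's inequality rearranged through x^(p-1) x = x^p: the tangent line of a convex function,
    obtained without differentiation. *)
Lemma powR_tangent p x y : 1 < p -> 0 <= x -> 0 <= y ->
  x `^ p + p * (x `^ (p - 1) * (y - x)) <= y `^ p.
Proof.
move=> p1 x0 y0; have := young_powR p1 x0 y0.
have <- := @mulr_powRB1 _ x p x0 ltac:(lra).
by set u := x `^ (p - 1); set v := y `^ p; lra.
Qed.

(** A ratio z / (x + y) in (0, 1] is at most its q-th power because q <= 1; the ratios for z = x and
    z = y add up to 1. *)
Lemma powR_subadditive q x y : 0 < q <= 1 -> 0 <= x -> 0 <= y ->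
  (x + y) `^ q <= x `^ q + y `^ q.
Proof.
move=> /andP[q0 q1]; rewrite le_eqVlt => /predU1P[<- y0|x0].
  by rewrite add0r lerDr powR_ge0.
rewrite le_eqVlt => /predU1P[<-|y0].
  by rewrite addr0 lerDl powR_ge0.
have s0 : 0 < x + y by rewrite addr_gt0.
have frac z : 0 < z -> z <= x + y -> (z / (x + y)) * (x + y) `^ q <= z `^ q.
  move=> z0 zs; rewrite -[in leRHS](@divfK _ (x + y) _ z) ?gt_eqF//.
  rewrite powRM ?divr_ge0 ?(ltW z0) ?(ltW s0)// ler_wpM2r ?powR_ge0//.
  by rewrite ger1_powR// divr_gt0//= ler_pdivrMr// mul1r.
have := lerD (frac _ x0 _) (frac _ y0 _).
rewrite -mulrDl -mulrDl divff ?gt_eqF// mul1r; apply.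
- by rewrite lerDl ltW.
- by rewrite lerDr ltW.
Qed.

(* [p * spow (p - 1) x] is the derivative of [`|x| `^ p]. *)
Definition spow q x := Num.sg x * `|x| `^ q.

Lemma norm_spow q x : 0 < q -> `|spow q x| = `|x| `^ q.
Proof.
move=> q0; rewrite /spow normrM normr_sg (ger0_norm (powR_ge0 _ _)).
by have [->|_] := eqVneq x 0; rewrite ?mul1r// mul0r normr0 powR0 ?gt_eqF.
Qed.

Lemma spowN q x : spow q (- x) = - spow q x.
Proof. by rewrite /spow sgrN normrN mulNr. Qed.

Lemma spow_powR q x : 0 < q -> 0 <= x -> spow q x = x `^ q.
Proof.
move=> q0; rewrite le_eqVlt => /predU1P[<-|x0].
  by rewrite /spow sgr0 mul0r powR0 ?gt_eqF.
by rewrite /spow gtr0_sg// gtr0_norm// mul1r.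
Qed.

Lemma spow_mul p x : 1 < p -> spow (p - 1) x * x = `|x| `^ p.
Proof.
move=> p1; rewrite /spow mulrAC -normrEsg.
by rewrite mulr_powRB1//; lra.
Qed.

Let spow_holder_ge0 q x y : 0 < q <= 1 -> 0 <= x -> 0 <= y ->
  `|spow q x - spow q y| <= `|x - y| `^ q.
Proof.
move=> q01 x0 y0; have q0 : 0 < q by case/andP: q01.
wlog yx : x y x0 y0 / y <= x => [H|].
  by have [|/ltW] := leP y x; [exact: H|rewrite distrC (distrC x); exact: H].
rewrite !spow_powR// !ger0_norm ?subr_ge0//; last first.
  by rewrite ge0_ler_powR ?nnegrE ?(ltW q0).
rewrite lerBlDr -[in leLHS](subrK y x) powR_subadditive// subr_ge0//.
Qed.

(** For arguments of the same sign this is subadditivity of the q-th power, with constant 1. For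
    opposite signs the left side is |x|^q + |y|^q and both terms are at most |x - y|^q, whence the
    2. *)
Lemma spow_holder q x y : 0 < q <= 1 ->
  `|spow q x - spow q y| <= 2 * `|x - y| `^ q.
Proof.
move=> q01; have q0 : 0 < q by case/andP: q01.
have le2 (z w : R) : 0 <= w -> z <= w -> z <= 2 * w by move=> w0 zw; lra.
have opposite (a c : R) : 0 <= a -> c <= 0 ->
    `|spow q a - spow q c| <= 2 * `|a - c| `^ q.
  move=> a0 c0; rewrite -(opprK c) spowN opprK opprK; set e := - c.
  have e0 : 0 <= e by rewrite oppr_ge0.
  rewrite !spow_powR// !ger0_norm ?addr_ge0 ?powR_ge0//.
  have : a `^ q <= (a + e) `^ q.
    by rewrite ge0_ler_powR ?nnegrE ?addr_ge0 ?(ltW q0)// lerDl.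
  have : e `^ q <= (a + e) `^ q.
    by rewrite ge0_ler_powR ?nnegrE ?addr_ge0 ?(ltW q0)// lerDr.
  lra.
have [x0|/ltW x0] := leP 0 x; have [y0|/ltW y0] := leP 0 y.
- by apply: le2; rewrite ?powR_ge0 ?spow_holder_ge0.
- exact: opposite.
- by rewrite distrC (distrC x); exact: opposite.
- apply: le2; rewrite ?powR_ge0//.
  have -> : spow q x - spow q y = spow q (- y) - spow q (- x).
    by rewrite !spowN; ring.
  have -> : x - y = - y - - x by ring.
  by rewrite spow_holder_ge0 ?oppr_ge0.
Qed.

(* Convexity gives the bound with the derivative taken at [x + y]; by Hoelder
   continuity it differs from the derivative at [x] by at most a multiple of
   [`|y| `^ (p - 1)]. *)
Lemma normD_powR p x y : 1 < p <= 2 ->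
  `|x + y| `^ p <= `|x| `^ p + p * (spow (p - 1) x * y) + 4 * `|y| `^ p.
Proof.
move=> /andP[p1 p2].
have T : `|x + y| `^ p <= `|x| `^ p + p * (spow (p - 1) (x + y) * y).
  have := young_powR p1 (normr_ge0 (x + y)) (normr_ge0 x).
  have : spow (p - 1) (x + y) * x <= `|x + y| `^ (p - 1) * `|x|.
    by rewrite (le_trans (ler_norm _))// normrM norm_spow//; lra.
  have := spow_mul (x + y) p1; rewrite mulrDr => <-.
  have := powR_ge0 `|x| p.
  nra.
apply: (le_trans T); rewrite -addrA lerD2l -lerBlDl -mulrBr -mulrBl.
rewrite (le_trans (ler_norm _))// !normrM (gtr0_norm (x := p)); last by lra.
(* The Hoelder constant 2 times the factor p <= 2 yields the final constant 4. *)
have H : `|spow (p - 1) (x + y) - spow (p - 1) x| <= 2 * `|y| `^ (p - 1).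
  rewrite (le_trans (spow_holder _ _ _))//; first by lra.
  by rewrite addrAC subrr add0r.
have := ler_wpM2r (normr_ge0 y) H.
rewrite -mulrA (mulrC (`|y| `^ _)) mulr_powRB1//; last by lra.
have := powR_ge0 `|y| p.
set u := `|_| * `|y|; have : 0 <= u by rewrite mulr_ge0.
nra.
Qed.

(** Jensen's inequality for weights of arbitrary total W: the tangent inequalities at the mean m = S
    / W are summed, and their linear parts cancel. *)
Lemma powR_weighted_mean p (I : finType) (A : pred I) (w a : I -> R) :
  1 < p -> (forall i, A i -> 0 <= w i) -> (forall i, A i -> 0 <= a i) ->
  (\sum_(i | A i) w i * a i) `^ p <=
  (\sum_(i | A i) w i) `^ (p - 1) * \sum_(i | A i) w i * a i `^ p.
Proof.
move=> p1 w0 a0; set W := \sum_(i | A i) w i.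
have W0 : 0 <= W by exact: sumr_ge0.
have [WE|WN] := eqVneq W 0.
  rewrite big1 ?powR0 ?gt_eqF//; [|lra|] => [|i Ai]; last first.
    by rewrite (psumr_eq0P w0 WE)// mul0r.
  by rewrite mulr_ge0 ?powR_ge0// sumr_ge0// => i Ai; rewrite mulr_ge0 ?w0 ?powR_ge0.
have {WN}W0 : 0 < W by rewrite lt_neqAle eq_sym WN.
set S := \sum_(i | A i) w i * a i; pose m := S / W.
have S0 : 0 <= S by apply: sumr_ge0 => i Ai; rewrite mulr_ge0 ?w0 ?a0.
have m0 : 0 <= m by rewrite divr_ge0// ltW.
have : \sum_(i | A i) w i * (m `^ p + p * (m `^ (p - 1) * (a i - m))) <=
       \sum_(i | A i) w i * a i `^ p.
  by apply: ler_sum => i Ai; rewrite ler_wpM2l ?w0// powR_tangent ?a0.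
rewrite [leLHS](_ : _ = W * m `^ p); last first.
  transitivity (\sum_(i | A i) (w i * (m `^ p - p * m `^ (p - 1) * m) +
     w i * a i * (p * m `^ (p - 1)))); first by apply: eq_bigr => i _; ring.
  rewrite big_split/= -!mulr_suml -/S -/W.
  have -> : S = m * W by rewrite /m divfK ?gt_eqF.
  by ring.
rewrite -(ler_pM2l (powR_gt0 (p - 1) W0)) => /(le_trans _); apply.
rewrite mulrA [W `^ _ * W]mulrC mulr_powRB1 ?(ltW W0)//; last by lra.
have WS : W * m = S by rewrite /m mulrC divfK ?gt_eqF.
by rewrite -powRM ?WS ?(ltW W0).
Qed.

End power_inequalities.

(** * Independence of set systems and products of independent variables *)

Section independent_systems.
Context dO (Omega : measurableType dO) (R : realType) (P : probability Omega R).
Implicit Types (F G H : set_system Omega).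

Definition indep_systems F G : Prop :=
  forall A B, F A -> G B -> P (A `&` B) = (P A * P B)%E.

(** For fixed B in G, the finite measures P(A & B) and P(A) P(B) of A agree on the pi-system F,
    hence on the sigma-algebra it generates. *)
Lemma indep_systems_sigma F G : setI_closed F -> F setT ->
  F `<=` measurable -> G `<=` measurable ->
  indep_systems F G -> indep_systems <<s F >> G.
Proof.
move=> FI FT mF mG FG A B sFA GB.
have mB : measurable B := mG _ GB.
pose q : {nonneg R} := NngNum (fine_ge0 (measure_ge0 P B)).
transitivity (mrestr P mB A); first by [].
transitivity (mscale q P A); last first.
  by rewrite /mscale/= fineK ?fin_num_measure// muleC.
apply: (@g_sigma_algebra_measure_unique _ _ _ F mF (fun=> setT)) => //.
- by rewrite bigcup_const.
- move=> C FC /=; rewrite /mrestr /mscale/= fineK ?fin_num_measure// muleC.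
  exact: FG.
- move=> _; rewrite /= /mrestr setTI.
  by rewrite ltey_eq fin_num_measure.
Qed.

(** Finite intersections of events taken from the [F i], i in S, form a pi-system that generates the
    join; for them the claim is the product rule over J and over J with k added. *)
Lemma mutually_independent_join (I : choiceType) (A S : set I)
    (F : I -> set_system Omega) (k : I) :
  (forall i, A i -> setI_closed (F i)) -> (forall i, A i -> F i setT) ->
  (forall i, A i -> F i `<=` measurable) ->
  mutually_independent P A F -> S `<=` A -> A k -> ~ S k ->
  indep_systems <<s \bigcup_(i in S) F i >> (F k).
Proof.
move=> FI FT mF indF SA Ak NSk.
pose C : set_system Omega := [set B | exists2 J : {fset I}, [set` J] `<=` S &
  exists2 E : I -> set Omega, (forall i, i \in J -> F i (E i)) &
    B = \bigcap_(i in [set` J]) E i].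
have mC : C `<=` measurable.
  move=> _ [J JS [E FE ->]]; apply: fin_bigcap_measurable => // i /= iJ.
  by apply: mF (FE _ iJ); apply/SA/JS.
have CI : setI_closed C.
  move=> _ _ [J JS [E FE ->]] [J' JS' [E' FE' ->]].
  (* Padding with the whole space lets intersections over J and J' both be indexed by their
     union. *)
  pose D (J : {fset I}) (E : I -> set Omega) i := if i \in J then E i else setT.
  exists (J `|` J')%fset.
    by move=> i /=; rewrite in_fsetU => /orP[/JS|/JS'].
  have FD (K : {fset I}) (G : I -> set Omega) i : A i ->
      (forall i, i \in K -> F i (G i)) -> F i (D K G i).
    by move=> Ai FG; rewrite /D; case: ifPn => [/FG//|_]; exact: FT.
  exists (fun i => D J E i `&` D J' E' i).
    move=> i; rewrite in_fsetU => iJJ'.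
    have Ai : A i by apply: SA; case/orP: iJJ' => [/JS|/JS'].
    by apply: FI => //; exact: FD.
  apply/seteqP; split => w.
    move=> [wE wE'] i /= _; rewrite /D; split; case: ifPn => // iJ.
      exact: wE.
    exact: wE'.
  move=> H; split => i /= iJ.
    by have [] := H i; rewrite /= /D ?in_fsetU iJ.
  by have [] := H i; rewrite /= /D ?in_fsetU iJ ?orbT.
have sC : \bigcup_(i in S) F i `<=` C.
  move=> B [i Si FiB]; exists [fset i]%fset.
    by move=> j /=; rewrite in_fset1 => /eqP ->.
  exists (fun=> B); first by move=> j; rewrite in_fset1 => /eqP ->.
  apply/seteqP; split => w; first by move=> Bw j.
  by move=> /(_ i); apply; rewrite /= in_fset1.
have indC : indep_systems <<s C >> (F k).
  apply: indep_systems_sigma => //; last 2 first.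
  - exact: mF.
  - move=> _ B [J JS [E FE ->]] FB.
    have kJ : k \notin J by apply/negP => /JS.
    pose E' i := if i == k then B else E i.
    have NJ i : i \in J -> (i == k) = false.
      by move=> iJ; apply/negbTE; apply: contraNneq kJ => <-.
    have kJA : [set` (k |` J)%fset] `<=` A.
      by move=> i; rewrite /= in_fset1U => /orP[/eqP ->//|/JS /SA].
    have FE' i : i \in (k |` J)%fset -> F i (E' i).
      by rewrite in_fset1U /E'; case: eqVneq => [->//|_ /=]; exact: FE.
    have := indF _ kJA _ FE'.
    rewrite set_fsetU1 bigcap_setU1 big_fsetU1//= {1 3}/E' eqxx setIC.
    have <- : \bigcap_(i in [set` J]) E i = \bigcap_(i in [set` J]) E' i.
      by apply: eq_bigcapr => i /= iJ; rewrite /E' NJ.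
    move=> ->; rewrite muleC; congr (_ * _)%E.
    rewrite (indF J (subset_trans JS SA))//.
    by rewrite big_seq [RHS]big_seq; apply: eq_bigr => i iJ; rewrite /E' NJ.
  - exists fset0 => //; exists (fun=> setT) => //.
    by apply/seteqP; split.
move=> X Y sX; apply: indC; exact: sub_sigma_algebra2 sX.
Qed.

(** On the pi-system of sets A & B, independence is used twice: P(A & B & E) = P(A) P(B & E) since B
    & E lies in K, and then P(B & E) = P(B) P(E). In the application F is the past, K the whole
    current level, H the current cube and G the other cubes of its block. *)
Lemma indep_systems_join F G H K :
  setI_closed F -> setI_closed G -> setI_closed K ->
  F setT -> G setT ->
  F `<=` measurable -> K `<=` measurable -> G `<=` K -> H `<=` K ->
  indep_systems F K -> indep_systems G H ->
  indep_systems <<s F `|` G >> H.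
Proof.
move=> FI GI KI FT GT mF mK GK HK FK GH.
pose C : set_system Omega := [set A `&` B | A in F & B in G].
have indC : indep_systems <<s C >> H.
  apply: indep_systems_sigma.
  - move=> _ _ [A FA [B GB <-]] [A' FA' [B' GB' <-]].
    by exists (A `&` A'); [exact: FI|exists (B `&` B'); [exact: GI|rewrite setIACA]].
  - by exists setT => //; exists setT => //; rewrite setTI.
  - by move=> _ [A FA [B GB <-]]; apply: measurableI; [exact: mF|exact/mK/GK].
  - exact: subset_trans mK.
  - move=> _ E [A FA [B GB <-]] HE; rewrite -setIA FK//; last first.
      by apply: KI; [exact: GK|exact: HK].
    by rewrite GH// FK ?muleA//; exact: GK.
move=> X Y sX; apply: indC; apply: sub_sigma_algebra2 sX => A [FA|GA].
  by exists A => //; exists setT => //; rewrite setIT.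
by exists setT => //; exists A => //; rewrite setTI.
Qed.

Section products.
Variables (U W : Omega -> R).
Hypotheses (mU : measurable_fun setT U) (mW : measurable_fun setT W).
Hypothesis UW : forall A B, measurable A -> measurable B ->
  P (U @^-1` A `&` W @^-1` B) = (P (U @^-1` A) * P (W @^-1` B))%E.

Let U' : {mfun Omega >-> R} := HB.pack U (isMeasurableFun.Build _ _ _ _ _ mU).
Let W' : {mfun Omega >-> R} := HB.pack W (isMeasurableFun.Build _ _ _ _ _ mW).

(** By [UW] the joint law of (U, W) agrees with the product of the marginal laws on rectangles,
    hence everywhere; Tonelli's theorem then iterates the integral. *)
Let indep_integral_comp (f : R * R -> \bar R) : measurable_fun setT f ->
  (forall z, 0 <= f z)%E ->
  (\int[P]_w f (U w, W w) =
   \int[distribution P U']_x \int[distribution P W']_y f (x, y))%E.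
Proof.
move=> mf f0; pose V w := (U w, W w).
have mV : measurable_fun setT V by exact: measurable_fun_pair.
transitivity (\int[pushforward P V]_z f z)%E.
  by rewrite ge0_integral_pushforward// => z _; exact: f0.
rewrite -(@fubini_tonelli1 _ _ _ _ _ (distribution P U') (distribution P W'))//.
apply: eq_measure_integral => A mA _.
apply/esym/(@product_measure_unique _ _ _ _ _ (distribution P U')
  (distribution P W') (pushforward P V)); first exact: UW.
exact: mA.
Qed.

Lemma indep_integralM_ge0 (f g : R -> R) :
  measurable_fun setT f -> measurable_fun setT g ->
  (forall x, 0 <= f x) -> (forall x, 0 <= g x) ->
  (\int[P]_w (f (U w) * g (W w))%:E =
   \int[P]_w (f (U w))%:E * \int[P]_w (g (W w))%:E)%E.
Proof.
move=> mf mg f0 g0.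
rewrite (@indep_integral_comp (fun z => (f z.1 * g z.2)%:E)); last 2 first.
- apply/measurable_EFinP/measurable_funM.
    exact: measurableT_comp.
  exact: measurableT_comp.
- by move=> z; rewrite lee_fin mulr_ge0.
transitivity (\int[distribution P U']_x
    ((f x)%:E * \int[distribution P W']_y (g y)%:E))%E.
  apply: eq_integral => x _ /=; under eq_integral do rewrite EFinM.
  rewrite ge0_integralZl//.
  - exact/measurable_EFinP.
  - by move=> y _; rewrite lee_fin.
  - by rewrite lee_fin.
rewrite ge0_integralZr//; last 3 first.
- exact/measurable_EFinP.
- by move=> y _; rewrite lee_fin.
- by apply: integral_ge0 => y _; rewrite lee_fin.
congr (_ * _)%E.
- rewrite (@ge0_integral_distribution _ _ _ _ _ P U' (EFin \o f))//.
  exact/measurable_EFinP.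
- rewrite (@ge0_integral_distribution _ _ _ _ _ P W' (EFin \o g))//.
  exact/measurable_EFinP.
Qed.

(** The product rule is stated for nonnegative factors, so it is applied to |U| for integrability
    and to the positive and negative parts of U for the value. *)
Lemma indep_integrable_mean1 :
  P.-integrable setT (EFin \o U) -> (forall w, 0 <= W w) ->
  (\int[P]_w (W w)%:E = 1)%E ->
  P.-integrable setT (EFin \o (U \* W)) /\
  (\int[P]_w (U w * W w)%:E = \int[P]_w (U w)%:E)%E.
Proof.
move=> iU W0 W1.
pose pos x : R := Num.max x 0; pose neg x : R := Num.max (- x) 0.
have mpos : measurable_fun setT pos by exact: measurable_maxr.
have mneg : measurable_fun setT neg by exact: measurable_maxr.
have g0 x : 0 <= (pos x : R) by rewrite le_max lexx orbT.
have WE (f : R -> R) : measurable_fun setT f -> (forall x, 0 <= f x) ->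
    (\int[P]_w (f (U w) * W w)%:E = \int[P]_w (f (U w))%:E)%E.
  (* [pos] does not change the nonnegative W; it supplies a factor that is nonnegative on all of
     R. *)
  move=> mf f0; transitivity (\int[P]_w (f (U w) * pos (W w))%:E)%E.
    by apply: eq_integral => w _; rewrite /pos max_l.
  rewrite indep_integralM_ge0//; rewrite [X in (_ * X)%E](_ : _ = 1%E) ?mule1//.
  by rewrite -W1; apply: eq_integral => w _; rewrite /pos max_l.
have mUW : measurable_fun setT (U \* W) by exact: measurable_funM.
split.
  apply/integrableP; split; first exact/measurable_EFinP.
  rewrite [ltLHS](_ : _ = \int[P]_w `|(U w)%:E|)%E; first by case/integrableP: iU.
  rewrite -(WE Num.norm)//.
  by apply: eq_integral => w _ /=; rewrite normrM (ger0_norm (W0 w)).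
rewrite integralE [RHS]integralE; congr (_ - _)%E.
- transitivity (\int[P]_w (pos (U w) * W w)%:E)%E.
    apply: eq_integral => w _; rewrite funeposE -EFin_max; congr EFin.
    by rewrite /pos maxr_pMl ?mul0r//.
  rewrite WE//; apply: eq_integral => w _; rewrite funeposE -EFin_max//.
- transitivity (\int[P]_w (neg (U w) * W w)%:E)%E.
    apply: eq_integral => w _; rewrite funenegE -EFinN -EFin_max; congr EFin.
    by rewrite /neg maxr_pMl ?mul0r// mulNr.
  rewrite WE//; last by move=> x; rewrite /neg le_max lexx orbT.
  by apply: eq_integral => w _; rewrite funenegE -EFinN -EFin_max.
Qed.

End products.
End independent_systems.

(** * Absolute p-th moments and the von Bahr--Esseen inequality *)

Section moments.
Context dO (Omega : measurableType dO) (R : realType) (P : probability Omega R).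
Variable p : R.
Hypothesis p12 : 1 < p <= 2.
Implicit Types (f g h S Z : Omega -> R).

Let p0 : 0 < p. Proof. by case/andP: p12; lra. Qed.
Let p1 : 1 < p. Proof. by case/andP: p12. Qed.

Definition moment f : \bar R := (\int[P]_w (`|f w| `^ p)%:E)%E.

Definition finite_moment f : Prop :=
  measurable_fun setT f /\ (moment f < +oo)%E.

Lemma moment_ge0 f : (0 <= moment f)%E.
Proof. by apply: integral_ge0 => w _; rewrite lee_fin powR_ge0. Qed.

Lemma measurable_abs_powR (q : R) f : measurable_fun setT f ->
  measurable_fun setT (fun w => `|f w| `^ q).
Proof.
move=> mf; apply: (measurableT_comp (measurable_powR q)).
exact: measurableT_comp.
Qed.

Lemma measurable_spow (q : R) f : measurable_fun setT f ->
  measurable_fun setT (fun w => spow q (f w)).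
Proof.
(* The indicators carry the sign; they also remove the value of 0^q, which is 1 when q = 0. *)
move=> mf; have -> : (fun w => spow q (f w)) =
    (fun w => Num.max (f w) 0 `^ q * (0 < f w)%R%:R -
              Num.max (- f w) 0 `^ q * (f w < 0)%R%:R).
  apply/funext => w; rewrite /spow; have [fw|fw|->] := ltgtP (f w) 0.
  - by rewrite ltr0_sg// ltr0_norm// max_l ?oppr_ge0 ?ltW//= mulr0 mulr1 mulN1r add0r.
  - by rewrite gtr0_sg// gtr0_norm///= mulr0 mulr1 mul1r subr0.
  - by rewrite sgr0 /= !mulr0 mul0r subr0.
have mlt g h : measurable_fun setT g -> measurable_fun setT h ->
    measurable_fun setT (fun w => (g w < h w)%R%:R : R).
  move=> mg mh; apply: (@measurableT_comp _ _ _ _ _ _ (fun b : bool => b%:R : R)) => //.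
  exact: measurable_fun_ltr.
apply: measurable_funB; apply: measurable_funM.
- apply: (measurableT_comp (measurable_powR q)); exact: measurable_maxr.
- exact: mlt.
- apply: (measurableT_comp (measurable_powR q)); apply: measurable_maxr => //.
  exact: measurableT_comp.
- exact: mlt.
Qed.

Lemma le_moment_integral f g : measurable_fun setT f -> measurable_fun setT g ->
  (forall w, `|f w| `^ p <= g w) -> (moment f <= \int[P]_w (g w)%:E)%E.
Proof.
move=> mf mg fg; apply: ge0_le_integral => //.
- exact/measurable_EFinP/measurable_abs_powR.
- exact/measurable_EFinP.
- by move=> w _; rewrite lee_fin.
Qed.

(** The left side is at most (2 max(|x|, |y|))^p, and 2^p <= 4 because p <= 2. *)
Lemma normD_powR_le (x y : R) :
  `|x + y| `^ p <= 4 * `|x| `^ p + 4 * `|y| `^ p.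
Proof.
wlog yx : x y / `|y| <= `|x|.
  move=> H; have [yx|/ltW xy] := leP `|y| `|x|; first exact: H.
  by rewrite addrC [leRHS]addrC; exact: H.
apply: (@le_trans _ _ ((2 * `|x|) `^ p)).
  rewrite ge0_ler_powR ?nnegrE ?(ltW p0) ?mulr_ge0//.
  by rewrite (le_trans (ler_normD _ _))//; lra.
rewrite powRM//.
have : 2 `^ p <= 4 :> R.
  have -> : 4 = 2 `^ 2%:R :> R by rewrite powR_mulrn//; ring.
  by rewrite ler_powR//; [lra|case/andP: p12].
have := powR_ge0 `|x| p; have := powR_ge0 `|y| p.
nra.
Qed.

Lemma ge0_integral_abs_powRD (c e : R) f g : 0 <= c -> 0 <= e ->
  measurable_fun setT f -> measurable_fun setT g ->
  (\int[P]_w (c * `|f w| `^ p + e * `|g w| `^ p)%:E =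
   c%:E * moment f + e%:E * moment g)%E.
Proof.
move=> c0 e0 mf mg; under eq_integral do rewrite EFinD.
have mM (a : R) h : measurable_fun setT h ->
    measurable_fun setT (fun w => (a * `|h w| `^ p)%:E).
  move=> mh; apply/measurable_EFinP/measurable_funM => //.
  exact: measurable_abs_powR.
rewrite ge0_integralD//; last 4 first.
- by move=> w _; rewrite lee_fin mulr_ge0 ?powR_ge0.
- exact: mM.
- by move=> w _; rewrite lee_fin mulr_ge0 ?powR_ge0.
- exact: mM.
have Z (a : R) h : 0 <= a -> measurable_fun setT h ->
    (\int[P]_w (a * `|h w| `^ p)%:E = a%:E * moment h)%E.
  move=> a0 mh; under eq_integral do rewrite EFinM.
  rewrite ge0_integralZl//.
  - exact/measurable_EFinP/measurable_abs_powR.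
by rewrite !Z.
Qed.

Lemma momentD f g : measurable_fun setT f -> measurable_fun setT g ->
  (moment (f \+ g)%R <= 4%:E * moment f + 4%:E * moment g)%E.
Proof.
move=> mf mg; rewrite -ge0_integral_abs_powRD//.
apply: le_moment_integral => [||w]; last exact: normD_powR_le.
  exact: measurable_funD.
by apply: measurable_funD; apply: measurable_funM => //; exact: measurable_abs_powR.
Qed.

Lemma momentZ (c : R) f : measurable_fun setT f ->
  moment (fun w => c * f w) = ((`|c| `^ p)%:E * moment f)%E.
Proof.
move=> mf; rewrite /moment -ge0_integralZl//.
- by apply: eq_integral => w _; rewrite normrM powRM// EFinM.
- exact/measurable_EFinP/measurable_abs_powR.
Qed.

Lemma finite_moment0 : finite_moment (fun=> 0).
Proof.
by split => //; rewrite /moment normr0 powR0 ?gt_eqF// integral0.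
Qed.

Lemma finite_momentD f g : finite_moment f -> finite_moment g ->
  finite_moment (f \+ g).
Proof.
move=> [mf ff] [mg fg]; split; first exact: measurable_funD.
apply: le_lt_trans (momentD mf mg) _.
by apply: lte_add_pinfty; apply: lte_mul_pinfty; [exact: ler0n| |exact: ff|
  exact: ler0n| |exact: fg].
Qed.

Lemma finite_momentZ (c : R) f : finite_moment f ->
  finite_moment (fun w => c * f w).
Proof.
move=> [mf ff]; split; first exact: measurable_funM.
rewrite (momentZ c mf); apply: lte_mul_pinfty; [|by []|exact: ff].
by rewrite lee_fin powR_ge0.
Qed.

Lemma finite_moment_sum (I : Type) (s : seq I) (A : pred I)
    (f : I -> Omega -> R) :
  (forall i, A i -> finite_moment (f i)) ->
  finite_moment (fun w => \sum_(i <- s | A i) f i w).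
Proof.
move=> ff; elim: s => [|i s IH].
  under eq_fun do rewrite big_nil; exact: finite_moment0.
case Ai : (A i); last by under eq_fun do rewrite big_cons Ai.
under eq_fun do rewrite big_cons Ai.
by apply: finite_momentD; [exact: ff|exact: IH].
Qed.

(** Young's inequality bounds |S|^(p-1) |Z| by |S|^p + |Z|^p. This gives a meaning to the
    orthogonality relations below. *)
Lemma finite_moment_spowM S Z : finite_moment S -> finite_moment Z ->
  P.-integrable setT (EFin \o (fun w => spow (p - 1) (S w) * Z w)).
Proof.
move=> [mS fS] [mZ fZ].
have mSZ : measurable_fun setT (fun w => spow (p - 1) (S w) * Z w).
  by apply: measurable_funM => //; exact: measurable_spow.
apply/integrableP; split; first exact/measurable_EFinP.
apply: (@le_lt_trans _ _
  (\int[P]_w (1 * `|S w| `^ p + 1 * `|Z w| `^ p)%:E)%E); last first.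
  rewrite (ge0_integral_abs_powRD ler01 ler01 mS mZ) !mul1e.
  exact: lte_add_pinfty fS fZ.
apply: ge0_le_integral => //.
- by apply/measurable_EFinP; exact: measurableT_comp.
- apply/measurable_EFinP.
  by apply: measurable_funD; apply: measurable_funM => //; exact: measurable_abs_powR.
move=> w _; rewrite /= lee_fin normrM norm_spow; last by rewrite subr_gt0.
have := young_powR p1 (normr_ge0 (S w)) (normr_ge0 (Z w)).
have := powR_ge0 `|S w| p; have := powR_ge0 `|Z w| p.
have : 0 <= `|S w| `^ (p - 1) * `|Z w| by rewrite mulr_ge0 ?powR_ge0.
have /andP[] := p12.
set u := _ * `|_|; set a := `|_| `^ p; set c := `|_| `^ p; nra.
Qed.

(** Integrating [normD_powR] leaves a linear term that vanishes by the last hypothesis, which stands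
    in for the martingale property. *)
Lemma moment_orthoD S Z : finite_moment S -> finite_moment Z ->
  (\int[P]_w (spow (p - 1) (S w) * Z w)%:E = 0)%E ->
  (moment (S \+ Z)%R <= moment S + 4%:E * moment Z)%E.
Proof.
move=> fS fZ SZ0; have iSZ := finite_moment_spowM fS fZ.
have [mS _] := fS; have [mZ _] := fZ.
have iS : P.-integrable setT (EFin \o (fun w => `|S w| `^ p)).
  apply/integrableP; split; first exact/measurable_EFinP/measurable_abs_powR.
  by under eq_integral do rewrite /= ger0_norm ?powR_ge0//; case: fS.
have iZ : P.-integrable setT (EFin \o (fun w => `|Z w| `^ p)).
  apply/integrableP; split; first exact/measurable_EFinP/measurable_abs_powR.
  by under eq_integral do rewrite /= ger0_norm ?powR_ge0//; case: fZ.
have iSZ' : P.-integrable setT (EFin \o (fun w => `|(S \+ Z) w| `^ p)).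
  apply/integrableP; split.
    exact/measurable_EFinP/measurable_abs_powR/measurable_funD.
  by under eq_integral do rewrite /= ger0_norm ?powR_ge0//;
     case: (finite_momentD fS fZ).
have i4Z := integrableZl measurableT 4 iZ.
have ipSZ := integrableZl measurableT p iSZ.
apply: (@le_trans _ _ (\int[P]_w ((`|S w| `^ p)%:E +
   (p%:E * (spow (p - 1) (S w) * Z w)%:E + 4%:E * (`|Z w| `^ p)%:E)))%E).
  apply: le_integral => //.
    by apply: integrableD => //; exact: integrableD.
  move=> w _; rewrite -!EFinM -!EFinD lee_fin addrA.
  exact: normD_powR.
rewrite integralD//; last exact: integrableD.
rewrite integralD// integralZl// integralZl//.
by rewrite SZ0 mule0 add0e.
Qed.

(** Terms are added one at a time with [moment_orthoD]. Independence is present only as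
    orthogonality of each term to the sums over other indices. *)
Lemma von_bahr_esseen (I : eqType) (s : seq I) (Z : I -> Omega -> R) :
  uniq s -> (forall i, i \in s -> finite_moment (Z i)) ->
  (forall i (s' : seq I), i \in s -> {subset s' <= s} -> i \notin s' ->
    \int[P]_w (spow (p - 1) (\sum_(j <- s') Z j w)%R * Z i w)%:E = 0)%E ->
  (moment (fun w => \sum_(i <- s) Z i w)%R <= 4%:E * \sum_(i <- s) moment (Z i))%E.
Proof.
elim: s => [_ _ _|i s IH /= /andP[is_ us] fZ H].
  under [X in moment X]eq_fun do rewrite big_nil.
  by rewrite /moment normr0 powR0 ?gt_eqF// integral0 big_nil mule0.
have fZs j : j \in s -> finite_moment (Z j).
  by move=> js; apply: fZ; rewrite in_cons js orbT.
have -> : (fun w => \sum_(j <- i :: s) Z j w) =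
          (fun w => \sum_(j <- s) Z j w) \+ Z i.
  by apply/funext => w; rewrite big_cons addrC.
rewrite big_cons ge0_muleDr//; [|exact: moment_ge0|]; last first.
  by apply: sume_ge0 => j _; exact: moment_ge0.
have ss : {subset s <= i :: s} by move=> j js; rewrite in_cons js orbT.
apply: le_trans (moment_orthoD _ _ _) _.
- have -> : (fun w => \sum_(j <- s) Z j w) =
            (fun w => \sum_(j <- s | j \in s) Z j w).
    by apply/funext => w; rewrite big_seq.
  exact: finite_moment_sum.
- by apply: fZ; rewrite mem_head.
- by apply: H => //; rewrite mem_head.
rewrite addeC leeD2l// IH// => j s' js s's js'.
by apply: H => //; [exact: ss|move=> k /s's /ss].
Qed.

(** The integrated form of [powR_weighted_mean]. Weights of total 1 cost nothing, N weights equal to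
    1 cost N^(p-1), and weights of small total give a gain. *)
Lemma moment_mean (I : finType) (A : pred I) (c : I -> R)
    (f : I -> Omega -> R) :
  (forall i, A i -> 0 <= c i) ->
  (forall i, A i -> measurable_fun setT (f i)) ->
  (moment (fun w => \sum_(i | A i) c i * f i w)%R <=
   ((\sum_(i | A i) c i)%R `^ (p - 1))%:E *
     \sum_(i | A i) (c i)%:E * moment (f i))%E.
Proof.
move=> c0 mf; set C := (\sum_(i | A i) c i) `^ (p - 1).
have mi i : A i -> measurable_fun setT (fun w => c i * `|f i w| `^ p).
  by move=> Ai; apply: measurable_funM => //; apply: measurable_abs_powR; exact: mf.
have mp : forall s : seq I, measurable_fun setT
    (fun w => \sum_(i <- s | A i) c i * `|f i w| `^ p).
  elim=> [|i s IH].
    by under eq_fun do rewrite big_nil; exact: measurable_cst.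
  case Ai : (A i); last by under eq_fun do rewrite big_cons Ai.
  under eq_fun do rewrite big_cons Ai.
  by apply: measurable_funD => //; exact: mi.
have ms : forall s : seq I, measurable_fun setT
    (fun w => \sum_(i <- s | A i) c i * f i w).
  elim=> [|i s IH].
    by under eq_fun do rewrite big_nil; exact: measurable_cst.
  case Ai : (A i); last by under eq_fun do rewrite big_cons Ai.
  under eq_fun do rewrite big_cons Ai.
  by apply: measurable_funD => //; apply: measurable_funM => //; exact: mf.
apply: (@le_trans _ _ (\int[P]_w (C * \sum_(i | A i) c i * `|f i w| `^ p)%:E)%E).
  apply: le_moment_integral => [||w].
  - exact: ms.
  - by apply: measurable_funM => //; exact: mp.
  rewrite (le_trans _ (powR_weighted_mean p1 c0 _))//.
  rewrite ge0_ler_powR ?nnegrE ?(ltW p0)//.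
    by apply: sumr_ge0 => i Ai; rewrite mulr_ge0 ?c0.
  rewrite (le_trans (ler_norm_sum _ _ _))//; apply: ler_sum => i Ai.
  by rewrite normrM (ger0_norm (c0 _ Ai)).
under eq_integral do rewrite EFinM.
have sum0 w : 0 <= \sum_(i | A i) c i * `|f i w| `^ p.
  by apply: sumr_ge0 => i Ai; rewrite mulr_ge0 ?c0 ?powR_ge0.
rewrite ge0_integralZl//; last 3 first.
- exact/measurable_EFinP/mp.
- by move=> w _; rewrite lee_fin.
- by rewrite lee_fin powR_ge0.
rewrite lee_wpmul2l ?lee_fin ?powR_ge0//.
under eq_integral do rewrite -sumEFin.
under eq_integral do rewrite big_mkcond/=.
rewrite ge0_integral_sum//; last 2 first.
- move=> i; case Ai : (A i); last exact: measurable_cst.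
  exact/measurable_EFinP/mi.
- by move=> i w _; case: ifPn => // Ai; rewrite lee_fin mulr_ge0 ?c0 ?powR_ge0.
rewrite [leRHS]big_mkcond; apply: lee_sum => i _; case Ai : (A i); last first.
  by rewrite integral0.
under eq_integral do rewrite EFinM.
rewrite ge0_integralZl//.
- exact/measurable_EFinP/measurable_abs_powR/mf.
- by rewrite lee_fin c0.
Qed.

End moments.

(** * Replacing an integral of the density by finite averages over sample points *)

Section sampling.
Context dO (Omega : measurableType dO) dT (T : measurableType dT)
  (R : realType) (P : probability Omega R)
  (mu : {sigma_finite_measure set T -> \bar R}).
Variable p : R.
Hypothesis p12 : 1 < p <= 2.
Variable q : Omega * T -> R.
Hypothesis mq : measurable_fun setT q.
Hypothesis q0 : forall z, 0 <= q z.
Hypothesis q1 : forall t, (\int[P]_w (q (w, t))%:E <= 1)%E.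
Variables (I : finType) (C : I -> set T) (c : I -> R).
Hypothesis mC : forall i, measurable (C i).
Hypothesis C0 : forall i, C i !=set0.
Hypothesis c0 : forall i, 0 <= c i.
Hypothesis muC : forall i, mu (C i) = (c i)%:E.
Hypothesis Cq : {ae mu, forall t, (exists i, C i t) \/ forall w, q (w, t) = 0}.
Variable B : R.
Hypothesis qB : forall t : I -> T, (forall i, C i (t i)) ->
  (moment P p (fun w => \sum_i c i * q (w, t i))%R <= B%:E)%E.

Let p1 : 1 < p. Proof. by case/andP: p12. Qed.
Let p0 : 0 < p. Proof. exact: lt_trans p1. Qed.
Let pB0 : 0 < p - 1. Proof. by rewrite subr_gt0. Qed.

Let M w : \bar R := (\int[mu]_t (q (w, t))%:E)%E.

Let mqE : measurable_fun setT (EFin \o q). Proof. exact/measurable_EFinP. Qed.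
Let q0E z : (0 <= (EFin \o q) z)%E. Proof. by rewrite lee_fin. Qed.

Let mM : measurable_fun setT M.
Proof. exact: (@measurable_fun_fubini_tonelli_F _ _ _ _ _ mu _ mqE q0E). Qed.

Let M0 w : (0 <= M w)%E.
Proof. by apply: integral_ge0 => t _; rewrite lee_fin. Qed.

Section truncated.
Variable K : R.
Hypothesis K0 : 0 <= K.

(** The cap K makes E[A^p] finite and bounds the function [g] below, so that its suprema over cells
    are finite. *)
Let A w : R := fine (mine (M w) K%:E).

Let AE w : (A w)%:E = mine (M w) K%:E.
Proof.
rewrite /A fineK// ge0_fin_numE; last by rewrite le_min M0 lee_fin K0.
by rewrite gt_min ltry orbT.
Qed.

Let A0 w : 0 <= A w.
Proof. by rewrite -lee_fin AE le_min M0 lee_fin K0. Qed.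

Let AK w : A w <= K.
Proof. by rewrite -lee_fin AE ge_min lexx orbT. Qed.

Let AM w : ((A w)%:E <= M w)%E.
Proof. by rewrite AE ge_min lexx. Qed.

Let mA : measurable_fun setT A.
Proof.
apply: measurableT_comp; first exact: fine_measurable.
apply: measurable_mine => //; exact: measurable_cst.
Qed.

Let mApow (r : R) : measurable_fun setT (fun w => A w `^ r).
Proof. exact: (measurableT_comp (measurable_powR r)). Qed.

(** Integrating over t gives M A^(p-1), which dominates A^p because A <= M; integrating over w first
    gives the deterministic function [g] of the point. *)
Let h (z : Omega * T) : \bar R := (q z * A z.1 `^ (p - 1))%:E.

Let mh : measurable_fun setT h.
Proof.
apply/measurable_EFinP/measurable_funM => //.
exact: (measurableT_comp (mApow _)).
Qed.

Let h0 z : (0 <= h z)%E.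
Proof. by rewrite lee_fin mulr_ge0 ?powR_ge0. Qed.

Let g t : \bar R := (\int[P]_w h (w, t))%E.

Let mg : measurable_fun setT g.
Proof. exact: (@measurable_fun_fubini_tonelli_G _ _ _ _ _ P _ mh h0). Qed.

Let g0 t : (0 <= g t)%E.
Proof. by apply: integral_ge0 => w _; exact: h0. Qed.

Let mqt t : measurable_fun setT (fun w => q (w, t)).
Proof. exact: (measurableT_comp mq (pair2_measurable t)). Qed.

Let mqw w : measurable_fun setT (fun t => q (w, t)).
Proof. exact: (measurableT_comp mq (pair1_measurable w)). Qed.

Let gK t : (g t <= (K `^ (p - 1))%:E)%E.
Proof.
apply: (@le_trans _ _ (\int[P]_w ((K `^ (p - 1))%:E * (q (w, t))%:E))%E).
  apply: ge0_le_integral; first exact: measurableT.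
  - by move=> w _; exact: h0.
  - exact: (measurableT_comp mh (pair2_measurable t)).
  - by apply/measurable_EFinP/measurable_funM => //; exact: mqt.
  - move=> w _; rewrite -EFinM lee_fin /= mulrC ler_wpM2r//.
    by rewrite ge0_ler_powR ?nnegrE// ltW.
rewrite ge0_integralZl//; last 3 first.
- exact/measurable_EFinP/mqt.
- by move=> w _; rewrite lee_fin.
- by rewrite lee_fin powR_ge0.
rewrite -[leRHS]mule1; apply: lee_wpmul2l; last exact: q1.
by rewrite lee_fin powR_ge0.
Qed.

Let gfin t : g t \is a fin_num.
Proof. by rewrite ge0_fin_numE// (le_lt_trans (gK t)) ?ltry. Qed.

Let moment_truncated_le : (\int[P]_w (A w `^ p)%:E <= \int[mu]_t g t)%E.
Proof.
rewrite -[leRHS](@fubini_tonelli _ _ _ _ _ P mu h mh h0).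
apply: ge0_le_integral; first exact: measurableT.
- by move=> w _; rewrite lee_fin powR_ge0.
- exact/measurable_EFinP/mApow.
- exact: (@measurable_fun_fubini_tonelli_F _ _ _ _ _ mu _ mh h0).
- move=> w _; rewrite /fubini_F
    (eq_integral (fun t => ((A w `^ (p - 1))%:E * (q (w, t))%:E)%E)); last first.
    by move=> t _; rewrite /h /= mulrC EFinM.
  rewrite ge0_integralZl//.
  + by rewrite -mulr_powRB1// mulrC EFinM lee_wpmul2l// lee_fin powR_ge0.
  + exact/measurable_EFinP/mqw.
  + by move=> t _; rewrite lee_fin.
  + by rewrite lee_fin powR_ge0.
Qed.

(** The supremum of [g] over a cell need not be attained, whence the error e. Since [g] is
    deterministic, the chosen point does not depend on w. *)
Let near_sup (e : R) i : 0 < e ->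
  exists2 t, C i t & forall t', C i t' -> (g t' <= g t + e%:E)%E.
Proof.
move=> e0; set s := ereal_sup (g @` C i).
have sfin : s \is a fin_num.
  rewrite ge0_fin_numE.
    rewrite (@le_lt_trans _ _ (K `^ (p - 1))%:E) ?ltry//.
    by apply: ub_ereal_sup => _ [t _ <-]; exact: gK.
  have [t Ct] := C0 i.
  by apply: (le_trans (g0 t)); apply: ereal_sup_ubound; exists t.
have [_ [t Ct <-] st] := ub_ereal_sup_adherent e0 sfin.
exists t => // t' Ct'; rewrite -leeBlDr//.
apply: le_trans (ltW st); rewrite leeB//.
by apply: ereal_sup_ubound; exists t'.
Qed.

Let integral_g_le (e : R) : 0 < e -> exists2 t : I -> T, (forall i, C i (t i)) &
  (\int[mu]_t g t <= \sum_i (c i)%:E * g (t i) + (\sum_i c i * e)%:E)%E.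
Proof.
move=> e0.
have /choice[t tP] : forall i, exists t, C i t /\
    forall t', C i t' -> (g t' <= g t + e%:E)%E.
  by move=> i; have [t Ct H] := near_sup i e0; exists t.
exists t; first by move=> i; case: (tP i).
have ge0 i : (0 <= g (t i) + e%:E)%E by rewrite adde_ge0// lee_fin ltW.
apply: (@le_trans _ _ (\int[mu]_t' \sum_i
   (g (t i) + e%:E) * (\1_(C i) t')%:E)%E).
  apply: ae_ge0_le_integral => //.
  - by move=> t' _; apply: sume_ge0 => i _; rewrite mule_ge0// lee_fin.
  - apply: emeasurable_sum => i; apply: measurable_funeM.
    exact/measurable_EFinP.
  apply: filterS Cq => t' + _.
  case=> [[i Ci]|qt'].
    rewrite (bigD1 i)//= indicE mem_set// mule1.
    apply: (@le_trans _ _ (g (t i) + e%:E)%E); first by case: (tP i) => _; exact.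
    by rewrite leeDl// sume_ge0// => j _; rewrite mule_ge0// lee_fin.
  have -> : g t' = 0%E.
    rewrite /g (eq_integral (fun=> 0%E)) ?integral0// => w _.
    by rewrite /h qt' mul0r.
  by apply: sume_ge0 => i _; rewrite mule_ge0// lee_fin.
rewrite ge0_integral_sum; first last.
- by move=> i t' _; rewrite mule_ge0// lee_fin.
- by move=> i; apply: measurable_funeM; exact/measurable_EFinP.
- exact: measurableT.
rewrite -sumEFin -big_split/=; apply: lee_sum => i _.
rewrite ge0_integralZl//; last exact/measurable_EFinP.
rewrite integral_indic// setIT [X in (_ * X)%E]muC muleC.
by rewrite -(fineK (gfin (t i))) -EFinD -!EFinM -EFinD mulrDr.
Qed.

(** Up to a small error, E[A^p] <= E[A^(p-1) Bt], and Young's inequality bounds p E[A^(p-1) Bt] by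
    (p - 1) E[A^p] + B. The finite term (p - 1) E[A^p] is then subtracted. *)
Let moment_truncated : (\int[P]_w (A w `^ p)%:E <= B%:E)%E.
Proof.
set a := (\int[P]_w (A w `^ p)%:E)%E.
have a0 : (0 <= a)%E by apply: integral_ge0 => w _; rewrite lee_fin powR_ge0.
have afin : a \is a fin_num.
  rewrite ge0_fin_numE; last exact: a0.
  apply: (@le_lt_trans _ _ (\int[P]_w (K `^ p)%:E)%E).
    apply: ge0_le_integral; first exact: measurableT.
    - by move=> w _; rewrite lee_fin powR_ge0.
    - exact/measurable_EFinP/mApow.
    - exact: measurable_cst.
    - by move=> w _; rewrite lee_fin ge0_ler_powR ?nnegrE// ltW.
  rewrite integral_cst; last exact: measurableT.
  by rewrite [X in (_ * X)%E]probability_setT mule1 ltry.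
set S := \sum_i c i; have S0 : 0 <= S by exact: sumr_ge0.
apply/lee_addgt0Pr => e e0.
(* The tolerance is e / (p (S + 1)): summing over the cells multiplies it by S, Young's inequality
   by p. The added 1 keeps the divisor positive. *)
have [t Ct H] := integral_g_le (divr_gt0 e0 (mulr_gt0 p0 (ltr_wpDl S0 ltr01))).
set e' := e / _ in H.
pose Bt w := \sum_i c i * q (w, t i).
have Bt0 w : 0 <= Bt w by apply: sumr_ge0 => i _; rewrite mulr_ge0.
have mBt : measurable_fun setT Bt.
  by apply: measurable_sum => i; apply: measurable_funM => //; exact: mqt.
have gE : (\sum_i (c i)%:E * g (t i) =
           \int[P]_w (A w `^ (p - 1) * Bt w)%:E)%E.
  transitivity (\int[P]_w (\sum_i (c i)%:E * h (w, t i)))%E.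
    rewrite ge0_integral_sum; first last.
    + by move=> i w _; rewrite mule_ge0// lee_fin.
    + move=> i; apply: measurable_funeM.
      exact: (measurableT_comp mh (pair2_measurable _)).
    + exact: measurableT.
    apply: eq_bigr => i _; apply/esym/ge0_integralZl; first exact: measurableT.
    + exact: (measurableT_comp mh (pair2_measurable _)).
    + by move=> w _; exact: h0.
    + by rewrite lee_fin.
  apply: eq_integral => w _; rewrite /Bt mulr_sumr -sumEFin.
  by apply: eq_bigr => i _; rewrite -EFinM; congr EFin; ring.
have young : (p%:E * \sum_i (c i)%:E * g (t i) <= (p - 1)%:E * a + B%:E)%E.
  rewrite gE -ge0_integralZl; [|exact: measurableT| | |]; last 3 first.
  - by apply/measurable_EFinP/measurable_funM.
  - by move=> w _; rewrite lee_fin mulr_ge0 ?powR_ge0.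
  - by rewrite lee_fin ltW.
  apply: (@le_trans _ _ (\int[P]_w ((p - 1)%:E * (A w `^ p)%:E +
                                    (`|Bt w| `^ p)%:E))%E).
    apply: ge0_le_integral; first exact: measurableT.
    + by move=> w _; rewrite lee_fin !mulr_ge0 ?powR_ge0 ?(ltW p0).
    + by apply/measurable_funeM/measurable_EFinP/measurable_funM.
    + apply: emeasurable_funD.
        exact/measurable_funeM/measurable_EFinP/mApow.
      exact/measurable_EFinP/measurable_abs_powR.
    move=> w _; rewrite -!EFinM -EFinD lee_fin (ger0_norm (Bt0 w)).
    exact: young_powR.
  rewrite ge0_integralD; first last.
  - exact/measurable_EFinP/measurable_abs_powR.
  - by move=> w _; rewrite lee_fin powR_ge0.
  - exact/measurable_funeM/measurable_EFinP/mApow.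
  - by move=> w _; rewrite lee_fin mulr_ge0 ?powR_ge0 ?(ltW pB0).
  - exact: measurableT.
  rewrite ge0_integralZl; first last.
  - by rewrite lee_fin ltW.
  - by move=> w _; rewrite lee_fin powR_ge0.
  - exact/measurable_EFinP/mApow.
  - exact: measurableT.
  apply: leeD; [exact: lexx|exact: qB].
have gtfin : (\sum_i (c i)%:E * g (t i))%E \is a fin_num.
  by apply/sum_fin_numP => i _ _; rewrite fin_numM.
have := le_trans moment_truncated_le H.
move: young; rewrite -/a -(fineK afin) -(fineK gtfin).
rewrite -mulr_suml -/S -!EFinM -!EFinD !lee_fin => young le_a.
have e'E : e = e' * p * (S + 1) by rewrite /e'; field; rewrite !gt_eqF//=; lra.
have e'0 : 0 < e' by rewrite divr_gt0// mulr_gt0//; lra.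
move: (p0) (p1) => ? ?; rewrite e'E; nra.
Qed.

Lemma truncated_moment_le :
  (\int[P]_w (mine (M w) K%:E `^ p) <= B%:E)%E.
Proof.
by under eq_integral do rewrite -AE poweR_EFin; exact: moment_truncated.
Qed.

End truncated.

(** The bound B is the same for every cap, so monotone convergence along K = n removes the
    truncation, even where the integral is infinite. *)
Lemma sampled_moment_le :
  (\int[P]_w ((\int[mu]_t (q (w, t))%:E) `^ p) <= B%:E)%E.
Proof.
pose F n w := (mine (M w) n%:R%:E `^ p)%E.
have mF n : measurable_fun setT (F n).
  apply: (measurableT_comp (measurable_poweR p)).
  apply: measurable_mine => //; exact: measurable_cst.
have F0 n w : (0 <= F n w)%E by exact: poweR_ge0.
have ndF w m n : (m <= n)%N -> (F m w <= F n w)%E.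
  move=> mn; have min0 k : (0 <= mine (M w) k%:R%:E)%E.
    by rewrite le_min M0 lee_fin ler0n.
  apply: gt0_ler_poweR; rewrite ?in_itv/= ?andbT ?min0 ?leey ?(ltW p0)//.
  by rewrite le_min ge_min lexx/= ge_min lee_fin ler_nat mn orbT.
have FM w : F n w @[n --> \oo] --> (M w `^ p)%E.
  have [MwE|Mwfin] := eqVneq (M w) +oo%E.
    rewrite MwE poweRyr ?gt_eqF// /F MwE.
    apply/cvgeyPge => r; near=> n.
    rewrite min_r ?leey// poweR_EFin lee_fin.
    have n1 : 1 <= n%:R :> R by near: n; exact: nbhs_infty_ger.
    rewrite (le_trans _ (le1r_powR n1 (ltW p1)))//.
    by near: n; exact: nbhs_infty_ger.
  apply: cvg_near_cst; near=> n; rewrite /F min_l//.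
  have Mf : M w \is a fin_num by rewrite ge0_fin_numE// ltey.
  rewrite -(fineK Mf) lee_fin.
  by near: n; exact: nbhs_infty_ger.
have cvgF : (\int[P]_w F n w)%E @[n --> \oo] --> (\int[P]_w (M w `^ p))%E.
  rewrite [X in _ --> X](_ : _ = \int[P]_w limn (F ^~ w))%E; last first.
    by apply: eq_integral => w _; apply/esym/cvg_lim => //; exact: FM.
  apply: cvg_monotone_convergence => //.
  by move=> w _ m n mn; exact: ndF.
apply: (cvge_to_le cvgF); apply: nearW => n.
exact: truncated_moment_le.
Unshelve. all: by end_near. Qed.

End sampling.

(** * Geometry of the b-adic cubes *)

Section badic_geometry.
Context {R : realType} (d b : nat).
Hypothesis b0 : (0 < b)%N.
Implicit Types (m k : nat) (t : d.-tuple R).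

Let bm0 m : 0 < b%:R ^+ m :> R.
Proof. by rewrite exprn_gt0// ltr0n. Qed.

Lemma measurable_tuple_box (A : 'I_d -> set R) :
  (forall i, measurable (A i)) ->
  measurable [set t : d.-tuple R | forall i, A i (tnth t i)].
Proof.
move=> mA; rewrite (_ : mkset _ = \bigcap_(i in [set: 'I_d])
    ((fun t : d.-tuple R => tnth t i) @^-1` A i)); last first.
  by apply/seteqP; split => [t At i _|t At i]; [exact: At|exact: (At i)].
apply: fin_bigcap_measurable => // i _.
by rewrite -[X in measurable X]setTI; exact: measurable_tnth.
Qed.

Let unit_cubeE :
  unit_cube d = [set t : d.-tuple R | forall i, `[0%R, 1%R]%classic (tnth t i)].
Proof.
by apply/seteqP; split => t + i => /(_ i); rewrite /= in_itv.
Qed.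

Let unit_cube_hoE :
  unit_cube_ho d = [set t : d.-tuple R | forall i, `[0%R, 1%R[%classic (tnth t i)].
Proof.
by apply/seteqP; split => t + i => /(_ i); rewrite /= in_itv.
Qed.

Lemma measurable_unit_cube : measurable (unit_cube d : set (d.-tuple R)).
Proof.
by rewrite unit_cubeE; exact: (@measurable_tuple_box (fun=> `[0%R, 1%R]%classic)).
Qed.

Lemma measurable_unit_cube_ho : measurable (unit_cube_ho d : set (d.-tuple R)).
Proof.
by rewrite unit_cube_hoE; exact: (@measurable_tuple_box (fun=> `[0%R, 1%R[%classic)).
Qed.

Lemma lebesgue_unit_cube : lebesgue_tuple d (unit_cube d : set (d.-tuple R)) = 1%E.
Proof.
rewrite unit_cubeE (@lebesgue_tuple_box _ d (fun=> `[0%R, 1%R]%classic))//.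
under eq_bigr do rewrite lebesgue_measure_itv/= lte_fin ltr01 oppr0 addr0.
by rewrite big1.
Qed.

Lemma lebesgue_unit_cube_ho :
  lebesgue_tuple d (unit_cube_ho d : set (d.-tuple R)) = 1%E.
Proof.
rewrite unit_cube_hoE (@lebesgue_tuple_box _ d (fun=> `[0%R, 1%R[%classic))//.
under eq_bigr do rewrite lebesgue_measure_itv/= lte_fin ltr01 oppr0 addr0.
by rewrite big1.
Qed.

Lemma unit_cube_hoS : unit_cube_ho d `<=` (unit_cube d : set (d.-tuple R)).
Proof. by move=> t tI i; have /andP[-> /ltW] := tI i. Qed.

(** The half-open b-adic cubes only cover [0,1)^d, whereas masses are taken over [0,1]^d. Both sets
    have measure 1, so their difference is null. *)
Lemma ae_unit_cube_ho :
  {ae (lebesgue_tuple d : set (d.-tuple R) -> \bar R),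
    forall t, unit_cube d t -> unit_cube_ho d t}.
Proof.
exists (unit_cube d `\` unit_cube_ho d); split.
- exact: measurableD measurable_unit_cube measurable_unit_cube_ho.
- rewrite measureD//=; last 3 first.
  + exact: measurable_unit_cube.
  + exact: measurable_unit_cube_ho.
  + by rewrite lebesgue_unit_cube ltry.
  rewrite setIidr; last exact: unit_cube_hoS.
  by rewrite lebesgue_unit_cube lebesgue_unit_cube_ho subee.
- by move=> t /= /not_implyP.
Qed.

Let badic_itv m (h : 'I_d -> 'I_(b ^ m)) i : set R :=
  `[(h i)%:R / b%:R ^+ m, (h i).+1%:R / b%:R ^+ m[%classic.

Let badic_cubeE m (h : 'I_d -> 'I_(b ^ m)) :
  badic_cube h = [set t : d.-tuple R | forall i, badic_itv h i (tnth t i)].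
Proof.
by apply/seteqP; split => t + i => /(_ i); rewrite /badic_itv /= in_itv.
Qed.

Lemma measurable_badic_cube m (h : 'I_d -> 'I_(b ^ m)) :
  measurable (badic_cube h : set (d.-tuple R)).
Proof.
by rewrite badic_cubeE; apply: measurable_tuple_box => i; exact: measurable_itv.
Qed.

Lemma lebesgue_badic_cube m (h : 'I_d -> 'I_(b ^ m)) :
  lebesgue_tuple d (badic_cube h : set (d.-tuple R)) =
  (((b%:R ^+ m)^-1 ^+ d)%:E)%E.
Proof.
rewrite badic_cubeE lebesgue_tuple_box; last by move=> i; exact: measurable_itv.
rewrite (eq_bigr (fun=> ((b%:R ^+ m)^-1 : R)%:E)); last first.
  move=> i _; rewrite lebesgue_measure_itv/= lte_fin ltr_pM2r ?invr_gt0//.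
  by rewrite ltr_nat leqnn -EFinD -mulrBl -natr1 [_ + 1]addrC addrK mul1r.
by rewrite prodEFin prodr_const card_ord.
Qed.

Lemma badic_cube_neq0 m (h : 'I_d -> 'I_(b ^ m)) :
  (badic_cube h : set (d.-tuple R)) !=set0.
Proof.
exists [tuple (h i)%:R / b%:R ^+ m | i < d] => i.
by rewrite tnth_mktuple lexx/= ltr_pM2r ?invr_gt0// ltr_nat.
Qed.

Lemma badic_cube_sub m (h : 'I_d -> 'I_(b ^ m)) :
  badic_cube h `<=` (unit_cube_ho d : set (d.-tuple R)).
Proof.
move=> t th i; have /andP[hl hr] := th i.
rewrite (le_trans _ hl) ?divr_ge0 ?ler0n ?ltW//= (lt_le_trans hr)//.
by rewrite ler_pdivrMr// mul1r -natrX ler_nat.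
Qed.

Lemma badic_cube_inj m (h h' : {ffun 'I_d -> 'I_(b ^ m)}) t :
  badic_cube h t -> badic_cube h' t -> h = h'.
Proof.
move=> th th'; apply/ffunP => i; apply/val_inj/eqP.
have /andP[hl hr] := th i; have /andP[hl' hr'] := th' i.
have := le_lt_trans hl hr'; have := le_lt_trans hl' hr.
rewrite !ltr_pM2r ?invr_gt0// !ltr_nat !ltnS => h1 h2.
by rewrite eqn_leq h1 h2.
Qed.

Lemma badic_cube_cover m t : unit_cube_ho d t ->
  exists h : {ffun 'I_d -> 'I_(b ^ m)}, badic_cube h t.
Proof.
move=> tI; pose n i := Num.truncn (tnth t i * b%:R ^+ m).
have tr i : (n i)%:R <= tnth t i * b%:R ^+ m < (n i).+1%:R.
  by apply: truncn_itv; rewrite mulr_ge0 ?(ltW (bm0 _))//; have /andP[] := tI i.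
have nb i : (n i < b ^ m)%N.
  rewrite -(ltr_nat R) natrX; have /andP[/le_lt_trans -> //] := tr i.
  by rewrite gtr_pMl//; have /andP[] := tI i.
exists [ffun i => Ordinal (nb i)] => i; rewrite ffunE /=.
by rewrite ler_pdivrMr// ltr_pdivlMr//; exact: tr.
Qed.

Section ancestor.
Variables (k m : nat).
Hypothesis km : (k <= m)%N.

Let ancestor_subproof (j : 'I_(b ^ m)) : (j %/ b ^ (m - k) < b ^ k)%N.
Proof.
by rewrite ltn_divLR ?expn_gt0 ?b0// -expnD subnKC.
Qed.

Definition ancestor (h : {ffun 'I_d -> 'I_(b ^ m)}) : {ffun 'I_d -> 'I_(b ^ k)} :=
  [ffun i => Ordinal (ancestor_subproof (h i))].

Lemma badic_cube_ancestor (h : {ffun 'I_d -> 'I_(b ^ m)}) :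
  badic_cube h `<=` (badic_cube (ancestor h) : set (d.-tuple R)).
Proof.
move=> t th i; have /andP[hl hr] := th i.
rewrite ffunE /=; set j := nat_of_ord (h i) in hl hr *.
pose e := (b ^ (m - k))%N; have e0 : (0 < e)%N by rewrite expn_gt0 b0.
have E n : n%:R / b%:R ^+ k = (n * e)%N%:R / b%:R ^+ m :> R.
  have -> : b%:R ^+ m = b%:R ^+ (m - k) * b%:R ^+ k :> R by rewrite -exprD subnK.
  by rewrite natrM natrX invfM mulrA mulfK// gt_eqF.
rewrite !E; apply/andP; split.
  by apply: le_trans hl; rewrite ler_pM2r ?invr_gt0// ler_nat leq_divM.
apply: lt_le_trans hr _; rewrite ler_pM2r ?invr_gt0// ler_nat.
by rewrite ltn_ceil.
Qed.

(** The coordinates decouple: in each, the indices with quotient [g i] are [g i * e + r] with r <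
    e. *)
Lemma card_ancestor (g : {ffun 'I_d -> 'I_(b ^ k)}) :
  #|[pred h | ancestor h == g]| = ((b ^ (m - k)) ^ d)%N.
Proof.
set e := (b ^ (m - k))%N; have e0 : (0 < e)%N by rewrite expn_gt0 b0.
have bme : (b ^ k * e = b ^ m)%N by rewrite -expnD subnKC.
transitivity #|family (fun i => [pred j : 'I_(b ^ m) | j %/ e == g i]%N)|.
  apply: eq_card => h; rewrite !inE; apply/eqP/familyP => [<- i|H].
    by rewrite inE ffunE.
  by apply/ffunP => i; apply/val_inj; rewrite ffunE /=; exact/eqP/H.
rewrite card_family.
have c1 i : #|[pred j : 'I_(b ^ m) | j %/ e == g i]%N| = e.
  have lt (r : 'I_e) : (g i * e + r < b ^ m)%N.
    rewrite -bme; apply: (@leq_trans ((g i).+1 * e)%N).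
      by rewrite mulSn addnC ltn_add2r.
    by rewrite leq_mul2r ltn_ord orbT.
  rewrite -[RHS](card_ord e) -(card_codom (f := fun r => Ordinal (lt r))); last first.
    by move=> r r' /(congr1 val) /= /addnI /val_inj.
  apply: eq_card => j; rewrite inE; apply/eqP/codomP => [jg|[r ->]] /=.
    exists (Ordinal (ltn_pmod j e0)); apply/val_inj => /=.
    by rewrite -jg -divn_eq.
  by rewrite divnMDl// divn_small// addn0.
rewrite foldrE big_image/= (eq_bigr (fun=> e)); last by move=> i _; exact: c1.
by rewrite prod_nat_const card_ord.
Qed.

End ancestor.
End badic_geometry.

(** * Past levels, neighbouring cubes and centered increments *)

Section level_independence.
Context dO (Omega : measurableType dO) (R : realType) (P : probability Omega R).
Context (d : nat) (X : nat -> Omega -> d.-tuple R -> R).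
Hypothesis X_measurable : forall m, jointly_measurable (X m).
Hypothesis X_indep : independent_processes P X.
Hypothesis X_ge0 : forall m w t, unit_cube d t -> 0 <= X m w t.
Hypothesis X_mean : forall m t, unit_cube d t -> 'E_P[X m ^~ t]%E = 1%E.
Implicit Types (m k : nat) (t : d.-tuple R) (S : set (d.-tuple R)).

Definition partial_prod n w t : R := \prod_(j < n) X j w t.

Lemma measurable_process m t : unit_cube d t -> measurable_fun setT (X m ^~ t).
Proof.
move=> It; apply: (@measurable_comp _ _ _ _ _ _ ([set: Omega] `*` unit_cube d)
    (fun z => X m z.1 z.2) setT (fun w => (w, t))).
- by apply: measurableX => //; exact: measurable_unit_cube.
- by move=> _ [w _ <-].
- exact: X_measurable.
- exact: pair2_measurable.
Qed.

Lemma process_mean m t : unit_cube d t -> (\int[P]_w (X m w t)%:E = 1)%E.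
Proof. by move=> /(X_mean m); rewrite unlock. Qed.

Lemma process_sigma_measurable m S : S `<=` unit_cube d ->
  process_sigma (X m) S `<=` measurable.
Proof.
move=> SI; apply: smallest_sub; first exact: sigma_algebra_measurable.
by move=> _ [t /SI It [A mA <-]]; exact: (measurable_process m It).
Qed.

Lemma process_sigma_sub m S S' : S `<=` S' ->
  process_sigma (X m) S `<=` process_sigma (X m) S'.
Proof. by move=> SS'; apply: sub_sigma_algebra2; exact: bigcup_subset. Qed.

Lemma process_sigma_preimage m S t (A : set R) : S t -> measurable A ->
  process_sigma (X m) S (X m ^~ t @^-1` A).
Proof.
move=> St mA; apply: sub_sigma_algebra; exists t => //; exists A => //.
by rewrite setTI.
Qed.

Lemma generated_setI_closed (G : set_system Omega) : setI_closed <<s G >>.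
Proof.
by move=> A B; exact: (@measurableI _ (g_sigma_algebraType G)).
Qed.

Lemma generated_setT (G : set_system Omega) : <<s G >> setT.
Proof. exact: (@measurableT _ (g_sigma_algebraType G)). Qed.

Definition past k : set_system Omega :=
  <<s \bigcup_(j in [set j | (j < k)%N]) process_sigma (X j) (unit_cube d) >>.

Lemma past_measurable k : past k `<=` measurable.
Proof.
apply: smallest_sub; first exact: sigma_algebra_measurable.
by move=> A [j _]; exact: process_sigma_measurable.
Qed.

Lemma generated_past k : <<s past k >> = past k.
Proof. by apply: sigma_algebra_id; exact: smallest_sigma_algebra. Qed.

Lemma past_indep k :
  indep_systems P (past k) (process_sigma (X k) (unit_cube d)).
Proof.
apply: (mutually_independent_join (A := setT)) => //.
- by move=> i _; exact: generated_setI_closed.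
- by move=> i _; exact: generated_setT.
- by move=> i _; exact: process_sigma_measurable.
- by rewrite /= ltnn.
Qed.

(** The information relative to which the level-k factor on the cube [J] is still fresh: the earlier
    levels and the other cubes of its block. *)
Definition past_and_others k (D : set (set (d.-tuple R))) J : set_system Omega :=
  <<s past k `|` <<s \bigcup_(S in D `\ J) process_sigma (X k) S >> >>.

(** Combines the two sources of independence: between levels, and between the cubes of one block at
    level k. *)
Lemma past_and_others_indep k D J :
  mutually_independent P D (process_sigma (X k)) ->
  (forall S, D S -> S `<=` unit_cube d) -> D J ->
  indep_systems P (past_and_others k D J) (process_sigma (X k) J).
Proof.
move=> indD DI DJ.
have mO : <<s \bigcup_(S in D `\ J) process_sigma (X k) S >> `<=`
    process_sigma (X k) (unit_cube d).
  apply: smallest_sub; first exact: smallest_sigma_algebra.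
  by move=> A [S [DS _]]; apply: process_sigma_sub; exact: DI.
apply: (@indep_systems_join _ _ _ P _ _ _ (process_sigma (X k) (unit_cube d))).
- exact: generated_setI_closed.
- exact: generated_setI_closed.
- exact: generated_setI_closed.
- exact: generated_setT.
- exact: generated_setT.
- exact: past_measurable.
- exact: process_sigma_measurable.
- exact: mO.
- by apply: process_sigma_sub; exact: DI.
- exact: past_indep.
apply: (mutually_independent_join (A := D)) => //.
- by move=> S _; exact: generated_setI_closed.
- by move=> S _; exact: generated_setT.
- by move=> S DS; apply: process_sigma_measurable; exact: DI.
- by move=> [_]; exact.
Qed.

(** Changing the sigma-algebra on the source type lets the closure lemmas for [measurable_fun] apply
    to sub-sigma-algebras. *)
Definition gmeasurable (G : set_system Omega) (f : Omega -> R) : Prop :=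
  @measurable_fun _ _ (g_sigma_algebraType G) R setT f.

Lemma gmeasurableP G f : (forall A, measurable A -> <<s G >> (f @^-1` A)) ->
  gmeasurable G f.
Proof. by move=> H _ A mA; rewrite setTI; exact: H. Qed.

Lemma gmeasurable_preimage G f (A : set R) : gmeasurable G f -> measurable A ->
  <<s G >> (f @^-1` A).
Proof. by move=> mf mA; have := mf measurableT A mA; rewrite setTI. Qed.

Lemma gmeasurable_sub G f : G `<=` measurable -> gmeasurable G f ->
  measurable_fun setT f.
Proof.
move=> Gm mf _ A mA; rewrite setTI; have := gmeasurable_preimage mf mA.
by apply: smallest_sub Gm _; exact: sigma_algebra_measurable.
Qed.

Lemma gmeasurable_partial_prod G k t :
  (forall j, (j < k)%N -> gmeasurable G (X j ^~ t)) ->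
  gmeasurable G ((partial_prod k) ^~ t).
Proof.
move=> H; rewrite /gmeasurable /partial_prod.
elim: k H => [|k IH] H.
  by under eq_fun do rewrite big_ord0; exact: measurable_cst.
under eq_fun do rewrite big_ord_recr; apply: measurable_funM; last exact: H.
by apply: IH => j jk; apply: H; rewrite (ltn_trans jk).
Qed.

Lemma gmeasurable_past G k j t : past k `<=` <<s G >> -> (j < k)%N ->
  unit_cube d t -> gmeasurable G (X j ^~ t).
Proof.
move=> pG jk It; apply: gmeasurableP => A mA; apply: pG.
by apply: sub_sigma_algebra; exists j => //; exact: process_sigma_preimage.
Qed.

Section orthogonality.
Variable p : R.
Hypothesis p12 : 1 < p <= 2.

(** The first two factors form a variable U measurable for G and integrable by Young's inequality.
    As X k t has mean 1 and is independent of G, E[U X] = E[U]. *)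
Lemma indep_centered_orthogonal (G : set_system Omega) k t (Y : Omega -> R) :
  G `<=` measurable -> past k `<=` <<s G >> -> unit_cube d t ->
  (forall A B, <<s G >> A -> measurable B ->
     P (A `&` (X k ^~ t) @^-1` B) = (P A * P ((X k ^~ t) @^-1` B))%E) ->
  gmeasurable G Y -> finite_moment P p Y ->
  finite_moment P p (partial_prod k ^~ t) ->
  (\int[P]_w (spow (p - 1) (Y w) * (partial_prod k w t * (X k w t - 1)))%:E = 0)%E.
Proof.
move=> Gm pG It GX mY fY fZ.
set U := fun w => spow (p - 1) (Y w) * partial_prod k w t.
have iU : P.-integrable setT (EFin \o U) by exact: finite_moment_spowM.
have gU : gmeasurable G U.
  apply: measurable_funM; first exact: measurable_spow.
  by apply: gmeasurable_partial_prod => j jk; exact: (gmeasurable_past pG).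
have mU := gmeasurable_sub Gm gU.
have UX' A B : measurable A -> measurable B ->
    P (U @^-1` A `&` X k ^~ t @^-1` B) =
    (P (U @^-1` A) * P (X k ^~ t @^-1` B))%E.
  by move=> mA mB; apply: GX => //; exact: gmeasurable_preimage.
have [iUX UX] := indep_integrable_mean1 mU (measurable_process k It) UX' iU
  (fun w => X_ge0 k w It) (process_mean k It).
transitivity (\int[P]_w ((U w * X k w t)%:E - (U w)%:E))%E.
  by apply: eq_integral => w _; rewrite -EFinB; congr EFin; rewrite /U; ring.
rewrite integralB_EFin// UX subee//; exact: integrable_fin_num iU.
Qed.

End orthogonality.
End level_independence.

(** * Moment bounds for the sampled masses *)

Lemma sum_fibers (V : nmodType) (I J : finType) (f : I -> J) (F : I -> V) :
  \sum_j \sum_(i | f i == j) F i = \sum_i F i.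
Proof. by rewrite [RHS](partition_big f predT). Qed.

Section discrete_estimate.
Context dO (Omega : measurableType dO) (R : realType) (P : probability Omega R).
Context (d b : nat) (X : nat -> Omega -> d.-tuple R -> R).
Hypothesis b0 : (0 < b)%N.
Hypothesis X_measurable : forall m, jointly_measurable (X m).
Hypothesis X_indep : independent_processes P X.
Hypothesis X_ge0 : forall m w t, unit_cube d t -> 0 <= X m w t.
Hypothesis X_mean : forall m t, unit_cube d t -> 'E_P[X m ^~ t]%E = 1%E.
Variables (p : R) (s : nat -> R).
Hypothesis p12 : 1 < p <= 2.
Hypothesis s1 : forall j, 1 <= s j.
Hypothesis X_moment : forall j t, unit_cube_ho d t ->
  (moment P p (X j ^~ t) <= (s j)%:E)%E.
Implicit Types (m k : nat) (t : d.-tuple R).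

Let p1 : 1 < p. Proof. by case/andP: p12. Qed.
Let p0 : 0 < p. Proof. exact: lt_trans p1. Qed.
Let pB0 : 0 < p - 1. Proof. by rewrite subr_gt0. Qed.

Let s_prod n : R := \prod_(j < n) s j.

Lemma measurable_partial_prod n t : unit_cube d t ->
  measurable_fun setT (partial_prod X n ^~ t).
Proof.
move=> It; rewrite /partial_prod; elim: n => [|n IH].
  by under eq_fun do rewrite big_ord0; exact: measurable_cst.
under eq_fun do rewrite big_ord_recr; apply: measurable_funM => //.
exact: (measurable_process X_measurable).
Qed.

Let past_process_indep k t (A B : set R) : unit_cube d t ->
  measurable A -> measurable B ->
  P (partial_prod X k ^~ t @^-1` A `&` X k ^~ t @^-1` B) =
  (P (partial_prod X k ^~ t @^-1` A) * P (X k ^~ t @^-1` B))%E.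
Proof.
move=> It mA mB; apply: (past_indep X_measurable X_indep (k := k)); last first.
  exact: process_sigma_preimage.
rewrite -generated_past; apply: gmeasurable_preimage => //.
apply: gmeasurable_partial_prod => j jk.
by apply: (gmeasurable_past (k := k)) => //; rewrite generated_past.
Qed.

Let moment_prod k t (f : R -> R) : unit_cube d t -> measurable_fun setT f ->
  moment P p (fun w => partial_prod X k w t * f (X k w t)) =
  (moment P p (partial_prod X k ^~ t) * moment P p (fun w => f (X k w t)))%E.
Proof.
move=> It mf; rewrite /moment.
transitivity (\int[P]_w (`|partial_prod X k w t| `^ p * `|f (X k w t)| `^ p)%:E)%E.
  by apply: eq_integral => w _; rewrite normrM powRM.
apply: (@indep_integralM_ge0 _ _ _ P (partial_prod X k ^~ t) (X k ^~ t)
  (measurable_partial_prod k It) (measurable_process X_measurable k It) _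
  (fun x => `|x| `^ p) (fun x => `|f x| `^ p)) => //.
- by move=> A B mA mB; exact: past_process_indep.
- exact: measurable_abs_powR.
- exact: measurable_abs_powR.
Qed.

Lemma partial_prod_mean n t : unit_cube d t ->
  (\int[P]_w (partial_prod X n w t)%:E = 1)%E.
Proof.
move=> It; elim: n => [|n IH].
  rewrite (eq_integral (fun=> 1%E)); last first.
    by move=> w _; rewrite /partial_prod big_ord0.
  rewrite integral_cst; last exact: measurableT.
  by rewrite [X in (_ * X)%E]probability_setT mule1.
have Q0 w : 0 <= partial_prod X n w t by apply: prodr_ge0 => j _; exact: X_ge0.
transitivity (\int[P]_w (`|partial_prod X n w t| * `|X n w t|)%:E)%E.
  apply: eq_integral => w _; rewrite (ger0_norm (Q0 w)) ger0_norm ?X_ge0//.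
  by rewrite /partial_prod big_ord_recr.
rewrite (@indep_integralM_ge0 _ _ _ P (partial_prod X n ^~ t) (X n ^~ t)
  (measurable_partial_prod n It) (measurable_process X_measurable n It) _
  (fun x => `|x|) (fun x => `|x|))//.
- under eq_integral do rewrite (ger0_norm (Q0 _)).
  under [X in (_ * X)%E]eq_integral do rewrite (ger0_norm (X_ge0 _ _ It)).
  by rewrite IH mul1e (process_mean X_mean).
- by move=> A B mA mB; exact: past_process_indep.
Qed.

Lemma moment_partial_prod n t : unit_cube_ho d t ->
  (moment P p (partial_prod X n ^~ t) <= (s_prod n)%:E)%E.
Proof.
move=> It; rewrite /s_prod; elim: n => [|n IH].
  rewrite big_ord0 /moment (eq_integral (fun=> 1%E)); last first.
    by move=> w _; rewrite /partial_prod big_ord0 normr1 powR1.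
  rewrite integral_cst; last exact: measurableT.
  by rewrite [X in (_ * X)%E]probability_setT mule1.
rewrite big_ord_recr/= EFinM.
have -> : partial_prod X n.+1 ^~ t =
    (fun w => partial_prod X n w t * id (X n w t)).
  by apply/funext => w; rewrite /partial_prod big_ord_recr.
have mid : measurable_fun setT (id : R -> R) by [].
rewrite (moment_prod n (unit_cube_hoS It) mid).
by apply: lee_pmul; [exact: moment_ge0|exact: moment_ge0|exact: IH|exact: X_moment].
Qed.

Lemma finite_moment_partial_prod n t : unit_cube_ho d t ->
  finite_moment P p (partial_prod X n ^~ t).
Proof.
move=> It; split; first exact/measurable_partial_prod/unit_cube_hoS.
exact: le_lt_trans (moment_partial_prod n It) (ltry _).
Qed.

Definition increment k t w := partial_prod X k w t * (X k w t - 1).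

(** The factor 8 comes from E|X - 1|^p <= 4 E[X^p] + 4 and 1 <= s k. *)
Lemma moment_increment k t : unit_cube_ho d t ->
  (moment P p (increment k t) <= (8 * s_prod k.+1)%:E)%E.
Proof.
move=> It; have IIt := unit_cube_hoS It.
have m1 : measurable_fun setT (fun x : R => x - 1) by exact: measurable_funB.
rewrite (moment_prod k IIt m1).
rewrite /s_prod big_ord_recr/= mulrCA EFinM.
apply: lee_pmul; [exact: moment_ge0|exact: moment_ge0|exact: moment_partial_prod|].
apply: (le_trans (momentD P p12 (f := X k ^~ t) (g := fun=> -1) _ _)).
- exact: (measurable_process X_measurable).
- exact: measurable_cst.
have -> : moment P p (fun=> -1) = 1%E.
  rewrite /moment normrN1 powR1 integral_cst; last exact: measurableT.
  by rewrite [X in (_ * X)%E]probability_setT mule1.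
apply: (@le_trans _ _ (4%:E * (s k)%:E + 4%:E * 1)%E).
  by apply: leeD => //; apply: lee_wpmul2l; [rewrite lee_fin|exact: X_moment].
by rewrite mule1 -EFinM -EFinD lee_fin; have := s1 k; lra.
Qed.

Lemma finite_moment_increment k t : unit_cube_ho d t ->
  finite_moment P p (increment k t).
Proof.
move=> It; have IIt := unit_cube_hoS It; split.
  apply: measurable_funM; first exact: measurable_partial_prod.
  apply: measurable_funB; last exact: measurable_cst.
  exact: (measurable_process X_measurable).
exact: le_lt_trans (moment_increment k It) (ltry _).
Qed.

Section sampled_points.
Variable m : nat.
Local Notation index l := {ffun 'I_d -> 'I_(b ^ l)}.
Variable t : index m -> d.-tuple R.
Hypothesis t_cube : forall h : index m, badic_cube h (t h).

Let t_ho h : unit_cube_ho d (t h). Proof. exact: badic_cube_sub (t_cube h). Qed.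
Let t_I h : unit_cube d (t h). Proof. exact/unit_cube_hoS/t_ho. Qed.

(** The Lebesgue measure of a b-adic cube of level l. *)
Let c l : R := (b%:R ^+ l)^-1 ^+ d.

Let bl0 l : 0 < b%:R ^+ l :> R.
Proof. by rewrite exprn_gt0// ltr0n. Qed.

Let c_ge0 l : 0 <= c l.
Proof. by rewrite exprn_ge0// invr_ge0 ltW. Qed.

Let card_index l : #|{: index l}|%:R * c l = 1.
Proof.
rewrite card_ffun !card_ord natrX natrX /c -exprMn divff ?expr1n// gt_eqF//.
Qed.

Let sum_c_ancestor l (lm : (l <= m)%N) (g : index l) :
  \sum_(h | ancestor b0 lm h == g) c m = c l.
Proof.
rewrite sumr_const card_ancestor -[LHS]mulr_natl natrX natrX /c -exprMn.
congr (_ ^+ d); rewrite -[in X in _ * X](subnK lm) exprD invfM mulrA divff ?mul1r//.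
by rewrite gt_eqF.
Qed.

(** Points and weights stay at level m while the number n of factors varies; this is the martingale
    in n. *)
Definition sampled_mass n w : R := \sum_h c m * partial_prod X n w (t h).

Lemma gmeasurable_sum (G : set_system Omega) (I : Type) (r : seq I)
    (A : pred I) (f : I -> Omega -> R) :
  (forall i, A i -> gmeasurable G (f i)) ->
  gmeasurable G (fun w => \sum_(i <- r | A i) f i w).
Proof.
move=> gf; rewrite /gmeasurable; elim: r => [|i r IH].
  by under eq_fun do rewrite big_nil; exact: measurable_cst.
case Ai : (A i); last by under eq_fun do rewrite big_cons Ai.
under eq_fun do rewrite big_cons Ai.
by apply: measurable_funD => //; exact: gf.
Qed.

Lemma gmeasurableZ (G : set_system Omega) (a : R) f :
  gmeasurable G f -> gmeasurable G (fun w => a * f w).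
Proof. by move=> gf; apply: measurable_funM => //; exact: measurable_cst. Qed.

Lemma finite_moment_sampled_mass n : finite_moment P p (sampled_mass n).
Proof.
apply: (finite_moment_sum p12) => h _; apply: finite_momentZ.
exact: finite_moment_partial_prod.
Qed.

(** A bound by Jensen's inequality alone. It grows with n and serves the levels up to k0, where
    independence between cubes is not assumed. *)
Lemma moment_sampled_mass_le n : (moment P p (sampled_mass n) <= (s_prod n)%:E)%E.
Proof.
apply: (le_trans (moment_mean P p12 (A := predT) (c := fun=> c m)
  (f := fun h => partial_prod X n ^~ (t h)) _ _)).
- by move=> h _; exact: c_ge0.
- by move=> h _; exact/measurable_partial_prod.
rewrite sumr_const -[_ *+ _]mulr_natl card_index powR1 mul1e.
apply: (@le_trans _ _ (\sum_(h : index m) (c m)%:E * (s_prod n)%:E)%E).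
  apply: lee_sum => h _; apply: lee_wpmul2l; first by rewrite lee_fin c_ge0.
  exact: moment_partial_prod.
rewrite sumEFin lee_fin sumr_const -mulr_natl mulrA card_index mul1r//.
Qed.

Let sum_orthogonal k (A : pred (index m)) (Y : Omega -> R) :
  finite_moment P p Y ->
  (forall h, A h ->
    \int[P]_w (spow (p - 1) (Y w) * increment k (t h) w)%:E = 0)%E ->
  (\int[P]_w (spow (p - 1) (Y w) *
     (\sum_(h | A h) c m * increment k (t h) w)%R)%:E = 0)%E.
Proof.
move=> fY H.
under eq_integral do rewrite mulr_sumr -sumEFin.
have iY h : P.-integrable setT
    (EFin \o (fun w => spow (p - 1) (Y w) * (c m * increment k (t h) w))).
  apply: (finite_moment_spowM p12 fY); apply: finite_momentZ.
  exact: finite_moment_increment.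
rewrite integral_sum//.
apply: big1 => h Ah.
under eq_integral do rewrite mulrCA EFinM.
rewrite integralZl//; last first.
  by apply: (finite_moment_spowM p12 fY); exact: finite_moment_increment.
by rewrite H// mule0.
Qed.

Section level_step.
Variables (k l : nat) (lm : (l <= m)%N).
Variables (N : nat) (D : 'I_N -> set (set (d.-tuple R))).
Hypothesis D_cover : \bigcup_i D i = badic_cubes d b l.
Hypothesis D_indep : forall i, mutually_independent P (D i) (process_sigma (X k)).

Let D_sub i (J : set (d.-tuple R)) : D i J -> J `<=` unit_cube d.
Proof.
move=> DJ; have : badic_cubes d b l J by rewrite -D_cover; exists i.
by move=> [h _ <-] u /(badic_cube_sub b0) /unit_cube_hoS.
Qed.

Let block_ex (g : index l) : exists i, D i (badic_cube g).
Proof.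
have : badic_cubes d b l (badic_cube g : set (d.-tuple R)) by exists g.
by rewrite -D_cover => -[i _ ?]; exists i.
Qed.

(** One chosen block containing the cube; the fibres of [block] partition the indices. *)
Let block (g : index l) : 'I_N := projT1 (cid (block_ex g)).

Let blockP g : D (block g) (badic_cube g).
Proof. exact: (projT2 (cid (block_ex g))). Qed.

(** The part of the stage-k increment carried by the sample points inside the level-l cube of index
    g. *)
Let Z (g : index l) w : R :=
  \sum_(h | ancestor b0 lm h == g) c m * increment k (t h) w.

Let fZ g : finite_moment P p (Z g).
Proof.
apply: (finite_moment_sum p12) => h _; apply: finite_momentZ.
exact: finite_moment_increment.
Qed.

(** Inside one cube only Jensen's inequality is used. The small total weight c l produces the gain c
    l^(p-1). *)
Let moment_Z g :
  (moment P p (Z g) <= (c l `^ (p - 1) * (c l * (8 * s_prod k.+1)))%:E)%E.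
Proof.
apply: (le_trans (moment_mean P p12 (c := fun=> c m)
  (f := fun h => increment k (t h)) _ _)).
- by move=> h _; exact: c_ge0.
- by move=> h _; case: (finite_moment_increment k (t_ho h)).
rewrite sum_c_ancestor EFinM; apply: lee_wpmul2l.
  by rewrite lee_fin powR_ge0.
apply: (@le_trans _ _ (\sum_(h | ancestor b0 lm h == g)
   (c m)%:E * (8 * s_prod k.+1)%:E)%E).
  apply: lee_sum => h _; apply: lee_wpmul2l; first by rewrite lee_fin c_ge0.
  exact: moment_increment.
under eq_bigr do rewrite -EFinM.
by rewrite sumEFin lee_fin -mulr_suml sum_c_ancestor.
Qed.

Let past_sub (G : set_system Omega) : past X k `<=` <<s past X k `|` G >>.
Proof. by move=> A pA; apply: sub_sigma_algebra; left. Qed.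

Let others_gen J i : set_system Omega :=
  past X k `|` <<s \bigcup_(S in D i `\ J) process_sigma (X k) S >>.

Let others_gen_measurable i J : others_gen J i `<=` measurable.
Proof.
move=> A [pA|]; first exact: (past_measurable X_measurable pA).
apply: smallest_sub; first exact: sigma_algebra_measurable.
move=> B [S [DS _]]; apply: process_sigma_measurable => //.
exact: D_sub DS.
Qed.

Let gmeasurable_Z i g g' : block g' = i -> g' != g ->
  gmeasurable (others_gen (badic_cube g) i) (Z g').
Proof.
move=> g'i g'g; apply: gmeasurable_sum => h /eqP hg'; apply: gmeasurableZ.
have Jh : badic_cube g' (t h) by rewrite -hg'; exact: badic_cube_ancestor.
apply: measurable_funM.
  apply: gmeasurable_partial_prod => j jk; apply: (gmeasurable_past (k := k)) => //.
  exact: past_sub.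
apply: measurable_funB; last exact: measurable_cst.
apply: gmeasurableP => A mA; apply: sub_sigma_algebra; right.
apply: sub_sigma_algebra; exists (badic_cube g'); last first.
  exact: process_sigma_preimage.
split; first by rewrite -g'i; exact: blockP.
(* Blocks consist of sets, so distinct indices must be shown to give distinct cubes: a point lies in
   only one cube of the level. *)
move=> /= E; move/negP: g'g; apply; apply/eqP.
by apply: (badic_cube_inj b0 Jh); rewrite -E.
Qed.

(** The other terms of the block are measurable for the past and the other cubes, so each summand of
    [Z g] is orthogonal to any function of their sum; linearity does the rest. *)
Let block_orthogonal i g (r : seq (index l)) : block g = i ->
  {in r, forall g', block g' = i} -> g \notin r ->
  (\int[P]_w (spow (p - 1) (\sum_(g' <- r) Z g' w)%R * Z g w)%:E = 0)%E.
Proof.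
move=> gi ri gr; pose J : set (d.-tuple R) := badic_cube g.
have sumE : (fun w => \sum_(g' <- r) Z g' w) =
            (fun w => \sum_(g' <- r | g' \in r) Z g' w).
  by apply/funext => w; rewrite big_seq.
have fS : finite_moment P p (fun w => \sum_(g' <- r) Z g' w).
  by rewrite sumE; apply: (finite_moment_sum p12) => g' _; exact: fZ.
apply: (sum_orthogonal fS) => h /eqP hg.
have Jh : J (t h) by rewrite /J -hg; exact: badic_cube_ancestor.
apply: (@indep_centered_orthogonal _ _ _ P _ X X_measurable X_ge0 X_mean p p12
  (others_gen J i)).
- exact: others_gen_measurable.
- exact: past_sub.
- exact: t_I.
- move=> A B sA mB.
  have DJ : D i J by rewrite -gi; exact: blockP.
  apply: (past_and_others_indep X_measurable X_indep (@D_indep i) (@D_sub i) DJ).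
    exact: sA.
  exact: process_sigma_preimage.
- rewrite sumE; apply: gmeasurable_sum => g' g'r; apply: gmeasurable_Z.
    exact: ri.
  by apply: contraNneq gr => <-.
- exact: fS.
- exact: finite_moment_partial_prod.
Qed.

Let Delta w : R := \sum_(i < N) \sum_(g | block g == i) Z g w.

Let DeltaE w : Delta w = \sum_h c m * increment k (t h) w.
Proof. by rewrite /Delta sum_fibers /Z sum_fibers. Qed.

Let sampled_massS w : sampled_mass k.+1 w = sampled_mass k w + Delta w.
Proof.
rewrite DeltaE -big_split/=; apply: eq_bigr => h _.
by rewrite /increment /partial_prod big_ord_recr/=; ring.
Qed.

Let fDelta : finite_moment P p Delta.
Proof.
apply: (finite_moment_sum p12) => i _; apply: (finite_moment_sum p12) => g _.
exact: fZ.
Qed.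

(** Jensen's inequality across the N blocks costs N^(p-1); inside a block the von Bahr--Esseen
    inequality applies. Summed over all cubes, one factor c l cancels against their number. *)
Let moment_Delta : (moment P p Delta <=
  (N%:R `^ (p - 1) * (4 * (c l `^ (p - 1) * (8 * s_prod k.+1))))%:E)%E.
Proof.
have DE : Delta = (fun w => \sum_(i < N) 1 * \sum_(g | block g == i) Z g w).
  by apply/funext => w; apply: eq_bigr => i _; rewrite mul1r.
rewrite DE; apply: (le_trans (moment_mean P p12 (A := predT) (c := fun=> 1)
  (f := fun i w => \sum_(g | block g == i) Z g w) _ _)) => //.
  move=> i _; have [] // : finite_moment P p (fun w => \sum_(g | block g == i) Z g w).
  by apply: (finite_moment_sum p12) => g _; exact: fZ.
rewrite sumr_const card_ord EFinM; apply: lee_wpmul2l.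
  by rewrite lee_fin powR_ge0.
apply: (@le_trans _ _ (\sum_(i < N) 4%:E * \sum_(g | block g == i)
   (c l `^ (p - 1) * (c l * (8 * s_prod k.+1)))%:E)%E).
  apply: lee_sum => i _; rewrite mul1e.
  pose r := [seq g <- index_enum (index l) | block g == i].
  have ri g : g \in r -> block g = i by rewrite mem_filter => /andP[/eqP].
  have -> : (fun w => \sum_(g | block g == i) Z g w) =
            (fun w => \sum_(g <- r) Z g w).
    by apply/funext => w; rewrite big_filter.
  rewrite -big_filter -/r.
  apply: (@le_trans _ _ (4%:E * \sum_(g <- r) moment P p (Z g))%E).
    apply: (@von_bahr_esseen _ _ _ P p p12 _ r Z).
    - by rewrite filter_uniq// index_enum_uniq.
    - by move=> g _; exact: fZ.
    - move=> g r' /ri gi r'r gr'; apply: (block_orthogonal gi) gr' => g' /r'r.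
      exact: ri.
  apply: lee_wpmul2l; first by rewrite lee_fin.
  by apply: lee_sum => g _; exact: moment_Z.
under eq_bigr do rewrite sumEFin -EFinM.
rewrite sumEFin lee_fin -mulr_sumr.
rewrite sum_fibers.
rewrite sumr_const -[_ *+ #|_|]mulr_natl.
rewrite [X in 4 * X](_ : _ =
  c l `^ (p - 1) * (#|{: index l}|%:R * c l * (8 * s_prod k.+1))).
  by rewrite card_index mul1r.
by ring.
Qed.

(** The increment is orthogonal to the previous mass because level k is independent of the past. The
    constant is 4 * 4 * 8, from [moment_orthoD], [von_bahr_esseen] and [moment_increment]. *)
Lemma moment_sampled_massS :
  (moment P p (sampled_mass k.+1) <= moment P p (sampled_mass k) +
   (128 * (N%:R `^ (p - 1) * (c l `^ (p - 1) * s_prod k.+1)))%:E)%E.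
Proof.
have -> : sampled_mass k.+1 = sampled_mass k \+ Delta.
  by apply/funext => w; rewrite sampled_massS.
apply: (le_trans (moment_orthoD p12 (finite_moment_sampled_mass k) fDelta _)).
  under eq_integral do rewrite DeltaE.
  apply: sum_orthogonal; first exact: finite_moment_sampled_mass.
  move=> h _.
  apply: (@indep_centered_orthogonal _ _ _ P _ X X_measurable X_ge0 X_mean p p12
    (past X k)).
  - exact: past_measurable.
  - exact: sub_sigma_algebra.
  - exact: t_I.
  - move=> A B sA mB; apply: (past_indep X_measurable X_indep (k := k)).
      by rewrite -generated_past.
    exact: process_sigma_preimage.
  - apply: gmeasurable_sum => h' _; apply: gmeasurableZ.
    apply: gmeasurable_partial_prod => j jk.
    by apply: (gmeasurable_past (k := k)) => //; exact: sub_sigma_algebra.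
  - exact: finite_moment_sampled_mass.
  - exact: finite_moment_partial_prod.
apply: leeD2l; apply: (le_trans (lee_wpmul2l _ moment_Delta)).
  by rewrite lee_fin.
by rewrite -EFinM lee_fin le_eqVlt; apply/orP; left; apply/eqP; ring.
Qed.

End level_step.
End sampled_points.
End discrete_estimate.

(** * Summability of the bounds over the levels *)

Section growth.
Context {R : realType}.

Lemma geometric_sum_le (r : R) n : 0 <= r < 1 ->
  \sum_(l < n) r ^+ l <= (1 - r)^-1.
Proof.
move=> /andP[r0 r1]; rewrite -[leRHS]mul1r ler_pdivlMr ?subr_gt0//.
rewrite mulrC -opprB mulNr -subrX1 opprB gerBl exprn_ge0//.
Qed.

Lemma prod_ge1_nd (s : nat -> R) n n' : (forall j, 1 <= s j) -> (n <= n')%N ->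
  \prod_(j < n) s j <= \prod_(j < n') s j.
Proof.
move=> s1 /subnK <-; elim: (n' - n)%N => [|k IH]; first by rewrite add0n.
rewrite addSn big_ord_recr/= (le_trans IH)// ler_peMr//.
by apply: prodr_ge0 => j _; rewrite (le_trans ler01).
Qed.

Lemma prod_le_geometric (s : nat -> R) (rho : R) j0 : (forall j, 1 <= s j) ->
  (forall j, (j0 <= j)%N -> s j <= rho) ->
  forall n, \prod_(j < n) s j <= (\prod_(j < j0) s j) * rho ^+ n.
Proof.
move=> s1 srho; have rho1 : 1 <= rho by rewrite (le_trans (s1 j0))// srho.
have prod0 n : 0 <= \prod_(j < n) s j.
  by apply: prodr_ge0 => j _; rewrite (le_trans ler01).
elim=> [|n IH]; first by rewrite expr0 mulr1; exact: prod_ge1_nd.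
have [nj0|j0n] := ltnP n j0.
  rewrite (le_trans (prod_ge1_nd s1 nj0))// ler_peMr//.
  by rewrite exprn_ege1.
rewrite big_ord_recr/= exprSr mulrA; apply: ler_pM => //.
- exact: prod0.
- by rewrite (le_trans ler01).
- exact: srho.
Qed.

Lemma subexponential_le (N : nat -> nat) (b : nat) (g : R) : (2 <= b)%N ->
  (forall eps : R, 0 < eps ->
     (fun m => (N m)%:R : R^o) =o_\oo (fun m => b%:R `^ (m%:R * eps) : R^o)) ->
  1 < g -> exists2 C, 0 < C & forall m, (N m)%:R <= C * g ^+ m.
Proof.
move=> b2 No g1; have b0 : 0 < b%:R :> R by rewrite ltr0n (leq_trans _ b2).
have lnb : 0 < ln b%:R :> R by rewrite ln_gt0// ltr1n.
(* Chosen so that b^eps = g. *)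
pose eps := ln g / ln b%:R.
have eps0 : 0 < eps by rewrite divr_gt0// ln_gt0.
have bE m : b%:R `^ (m%:R * eps) = g ^+ m.
  rewrite mulrC powRrM powR_mulrn ?powR_ge0//; congr (_ ^+ _).
  rewrite /powR gt_eqF// /eps divfK ?gt_eqF// lnK// posrE.
  exact: lt_trans g1.
have /eqoP /(_ 1 ltr01) := No eps eps0.
(* The sum covers the finitely many levels before the little-o bound with constant 1 takes
   effect. *)
case=> m0 _ H; exists (1 + \sum_(j < m0) (N j)%:R).
  by rewrite ltr_pwDl// sumr_ge0.
move=> m; have gm : 1 <= g ^+ m by rewrite exprn_ege1// ltW.
have [mm0|m0m] := ltnP m m0.
  rewrite (@le_trans _ _ (\sum_(j < m0) (N j)%:R))//.
    rewrite (bigD1 (Ordinal mm0))//= lerDl sumr_ge0//.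
  rewrite (@le_trans _ _ (1 + \sum_(j < m0) (N j)%:R)) ?lerDr//.
  by rewrite ler_peMr// addr_ge0// sumr_ge0.
have := H m m0m; rewrite /= mul1r bE normr_nat ger0_norm; last first.
  exact: le_trans gm.
move=> /le_trans; apply; rewrite mulrDl mul1r lerDl mulr_ge0//.
  by rewrite sumr_ge0.
exact: le_trans gm.
Qed.

(** The index l stands for the partition level k - 1, so the product over j <= k has l + 2
    factors. *)
Lemma level_terms_bounded (s : nat -> R) (N : nat -> nat) (b d : nat) (p : R)
    (rho : R) j0 :
  (2 <= b)%N -> 1 < p <= 2 -> (forall j, 1 <= s j) ->
  (forall j, (j0 <= j)%N -> s j <= rho) -> rho < b%:R `^ (d%:R * (p - 1)) ->
  (forall m, (0 < N m)%N) ->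
  (forall eps : R, 0 < eps ->
     (fun m => (N m)%:R : R^o) =o_\oo (fun m => b%:R `^ (m%:R * eps) : R^o)) ->
  exists B : R, forall n, \sum_(l < n) (N l)%:R `^ (p - 1) *
    (((b%:R ^+ l)^-1 ^+ d) `^ (p - 1) * \prod_(j < l.+2) s j) <= B.
Proof.
move=> b2 /andP[p1 p2] s1 srho; set beta := b%:R `^ _ => rhob N0 No.
have b0 : 0 < b%:R :> R by rewrite ltr0n (leq_trans _ b2).
have rho1 : 1 <= rho by rewrite (le_trans (s1 j0))// srho.
have rho0 : 0 < rho by exact: lt_le_trans rho1.
have beta0 : 0 < beta by exact: lt_trans rhob.
(* The gap between rho and the threshold beta is shared equally: N l may grow like g^l, and the
   ratio r = g rho / beta = 1 / g is still below 1. *)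
pose g := Num.sqrt (beta / rho).
have q1 : 1 < beta / rho by rewrite ltr_pdivlMr// mul1r.
have g1 : 1 < g by rewrite -sqrtr1 ltr_sqrt ?(lt_trans ltr01 q1).
have gg : g * g = beta / rho by rewrite -expr2 sqr_sqrtr// ltW// (lt_trans ltr01).
pose r := g * rho / beta.
have r0 : 0 <= r.
  by rewrite !mulr_ge0 ?invr_ge0 ?(ltW beta0) ?(ltW rho0)// ltW// (lt_trans ltr01).
have r1 : r < 1.
  rewrite /r ltr_pdivrMr// mul1r -ltr_pdivlMr// -gg.
  by rewrite ltr_pMr// (lt_trans ltr01).
have [C C0 NC] := subexponential_le b2 No g1.
have := prod_le_geometric s1 srho; set A := \prod_(j < j0) s j => HA.
have A0 : 0 <= A by apply: prodr_ge0 => j _; rewrite (le_trans ler01).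
exists (C * A * rho ^+ 2 * (1 - r)^-1) => n.
apply: (@le_trans _ _ (\sum_(l < n) C * A * rho ^+ 2 * r ^+ l)); last first.
  rewrite -mulr_sumr ler_wpM2l ?geometric_sum_le ?r0//.
  by rewrite !mulr_ge0 ?exprn_ge0// ltW.
apply: ler_sum => l _.
have cE : ((b%:R ^+ l)^-1 ^+ d) `^ (p - 1) = (beta^-1) ^+ l :> R.
  rewrite exprVn -exprM -powR_invn ?(ltW b0)// -powRrM.
  rewrite exprVn -powR_mulrn ?(ltW beta0)// -powRrM -powRN; congr (_ `^ _).
  by rewrite natrM; ring.
rewrite cE.
(* Since N l >= 1 and p - 1 <= 1, the power is at most N l itself. *)
have NB : (N l)%:R `^ (p - 1) <= C * g ^+ l.
  apply: le_trans (NC l); rewrite ler1_powR// ?ler1n//; lra.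
have -> : C * A * rho ^+ 2 * r ^+ l =
    (C * g ^+ l) * (beta^-1 ^+ l * (A * rho ^+ l.+2)).
  by rewrite /r !exprMn !exprS; ring.
apply: ler_pM => //.
  rewrite mulr_ge0 ?exprn_ge0 ?invr_ge0 ?(ltW beta0)//.
  by apply: prodr_ge0 => j _; rewrite (le_trans ler01).
by rewrite ler_wpM2l// exprn_ge0// invr_ge0 ltW.
Qed.

(** The upper limit is the infimum of the suprema of tails, so some tail has its supremum below c;
    that supremum is rho. *)
Lemma limn_esup_lt_near (u : (\bar R)^nat) (c : R) : (limn_esup u < c%:E)%E ->
  (forall n, (0 <= u n)%E) ->
  exists2 rho : R, rho < c & exists j0, forall j, (j0 <= j)%N -> (u j <= rho%:E)%E.
Proof.
move=> uc u0; move: uc; rewrite limn_esup_lim.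
rewrite (cvg_lim _ (@cvg_esups_inf R u))// => /ereal_inf_lt[_ [j0 _ <-]] Hj0.
have E0 : (0 <= esups u j0)%E.
  apply: le_trans (u0 j0) _; apply: ereal_sup_ubound.
  by exists j0 => /=.
have Ef : esups u j0 \is a fin_num.
  by rewrite ge0_fin_numE// (lt_trans Hj0)// ltry.
exists (fine (esups u j0)); first by rewrite -lte_fin fineK.
exists j0 => j j0j; rewrite fineK//; apply: ereal_sup_ubound.
by exists j.
Qed.

End growth.

(** * The total mass of the unit cube and its p0-th moment *)

Section total_mass.
Context dO (Omega : measurableType dO) (R : realType) (P : probability Omega R).
Context (d b : nat) (X : nat -> Omega -> d.-tuple R -> R).
Hypothesis d1 : (1 <= d)%N.
Hypothesis b2 : (2 <= b)%N.
Hypothesis X_measurable : forall m, jointly_measurable (X m).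
Hypothesis X_indep : independent_processes P X.
Hypothesis X_ge0 : forall m w t, unit_cube d t -> 0 <= X m w t.
Hypothesis X_mean : forall m t, unit_cube d t -> 'E_P[X m ^~ t]%E = 1%E.
Implicit Types (m k : nat) (t : d.-tuple R).

Let b0 : (0 < b)%N. Proof. exact: ltn_trans b2. Qed.

Let cubeT := [set: Omega] `*` (unit_cube d : set (d.-tuple R)).

(** Extended by 0 off the cube, where nothing is assumed of the processes, so that Tonelli's theorem
    applies on the whole product space. *)
Definition density m : Omega * d.-tuple R -> R :=
  (fun z => partial_prod X m.+1 z.1 z.2) \_ cubeT.

Let densityE m w t : unit_cube d t -> density m (w, t) = partial_prod X m.+1 w t.
Proof. by move=> It; rewrite /density patchE mem_set. Qed.

Let density0 m w t : ~ unit_cube d t -> density m (w, t) = 0.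
Proof. by move=> It; rewrite /density patchE memNset// => -[]. Qed.

Lemma measurable_density m : measurable_fun setT (density m).
Proof.
have mI : measurable cubeT by apply: measurableX => //; exact: measurable_unit_cube.
apply/(measurable_restrictT _ mI); rewrite /partial_prod.
elim: m.+1 => [|n IH].
  by under eq_fun do rewrite big_ord0; exact: measurable_cst.
by under eq_fun do rewrite big_ord_recr; apply: measurable_funM => //;
  exact: X_measurable.
Qed.

Lemma density_ge0 m z : 0 <= density m z.
Proof.
case: z => w t; have [It|It] := pselect (unit_cube d t).
  by rewrite densityE//; apply: prodr_ge0 => j _; exact: X_ge0.
by rewrite density0.
Qed.

Lemma chaos_cubeE m w :
  chaos X m w (unit_cube d) = (\int[lebesgue_tuple d]_t (density m (w, t))%:E)%E.
Proof.
rewrite /chaos setIid integral_mkcond; apply: eq_integral => t _.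
have [It|It] := pselect (unit_cube d t).
  by rewrite patchE mem_set// densityE.
by rewrite patchE memNset// density0.
Qed.

Lemma chaos_cube_ge0 m w : (0 <= chaos X m w (unit_cube d))%E.
Proof.
by rewrite chaos_cubeE; apply: integral_ge0 => t _; rewrite lee_fin density_ge0.
Qed.

Lemma density_mean m t : unit_cube d t -> (\int[P]_w (density m (w, t))%:E = 1)%E.
Proof.
move=> It; under eq_integral do rewrite densityE//.
exact: (partial_prod_mean X_measurable X_indep X_ge0 X_mean).
Qed.

Lemma density_mean_le m t : (\int[P]_w (density m (w, t))%:E <= 1)%E.
Proof.
have [It|It] := pselect (unit_cube d t); first by rewrite density_mean.
by under eq_integral do rewrite density0//; rewrite integral0.
Qed.

Let mdE m : measurable_fun setT (EFin \o density m).
Proof. by apply/measurable_EFinP; exact: measurable_density. Qed.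

Let d0E m z : (0 <= (EFin \o density m) z)%E.
Proof. by rewrite lee_fin density_ge0. Qed.

Lemma measurable_chaos_cube m :
  measurable_fun setT (fun w => chaos X m w (unit_cube d)).
Proof.
under eq_fun do rewrite chaos_cubeE.
exact: (@measurable_fun_fubini_tonelli_F _ _ _ _ _ (lebesgue_tuple d) _
  (mdE m) (d0E m)).
Qed.

Lemma chaos_cube_mean m : (\int[P]_w chaos X m w (unit_cube d) = 1)%E.
Proof.
under eq_integral do rewrite chaos_cubeE.
rewrite (@fubini_tonelli _ _ _ _ _ P (lebesgue_tuple d) _ (mdE m) (d0E m)).
rewrite (eq_integral (EFin \o (\1_(unit_cube d) : d.-tuple R -> R))).
  rewrite integral_indic//; last exact: measurable_unit_cube.
  by rewrite setIT; exact: lebesgue_unit_cube.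
move=> t _; rewrite /fubini_G /= indicE.
have [It|It] := pselect (unit_cube d t).
  by rewrite mem_set// density_mean.
rewrite memNset//; under eq_integral do rewrite density0//.
by rewrite integral0.
Qed.

Lemma chaos_cube_moment_bounded (p0 : R) :
  assumption1 P b X -> assumption2 P b X p0 ->
  exists B : R, forall m,
    (\int[P]_w (chaos X m w (unit_cube d) `^ p0) <= B%:E)%E.
Proof.
move=> [k0 [_ [N [N0 No [D [Dpart Dindep]]]]]] [p12 momlt mom_limsup].
have p00 : 0 < p0 by move: p12; lra.
have moment_sup j t : unit_cube_ho d t ->
    (moment P p0 (X j ^~ t) <= sup_moment P X p0 j)%E.
  move=> It; apply: ereal_sup_ubound; exists t => //.
  rewrite unlock; apply: eq_integral => w _.
  by rewrite ger0_norm// X_ge0//; exact: unit_cube_hoS.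
have sup_ge0 j : (0 <= sup_moment P X p0 j)%E.
  have I0 : unit_cube_ho d ([tuple 0 | i < d] : d.-tuple R).
    by move=> i; rewrite tnth_mktuple lexx ltr01.
  exact: le_trans (moment_ge0 P p0 _) (moment_sup j _ I0).
have sup_fin j : sup_moment P X p0 j \is a fin_num by rewrite ge0_fin_numE.
(* The maximum with 1 makes the products of the [s j] nondecreasing in the number of factors. *)
pose s j : R := Num.max 1 (fine (sup_moment P X p0 j)).
have s1 j : 1 <= s j by rewrite le_max lexx.
have X_moment j t : unit_cube_ho d t -> (moment P p0 (X j ^~ t) <= (s j)%:E)%E.
  move=> It; apply: le_trans (moment_sup j t It) _.
  by rewrite -(fineK (sup_fin j)) lee_fin le_max lexx orbT.
have [rho' rho'b [j0 Hj0]] := limn_esup_lt_near mom_limsup sup_ge0.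
pose rho : R := Num.max 1 rho'.
have srho j : (j0 <= j)%N -> s j <= rho.
  move=> jj0; rewrite /s /rho ge_max !le_max lexx/=.
  by rewrite -!lee_fin (fineK (sup_fin j)) Hj0// orbT.
(* The threshold exceeds 1 because d >= 1, b >= 2 and p0 > 1, so raising rho' to at least 1 keeps it
   below. *)
have rhob : rho < b%:R `^ (d%:R * (p0 - 1)).
  rewrite /rho gt_max rho'b andbT.
  have e0 : 0 < d%:R * (p0 - 1) by rewrite mulr_gt0 ?ltr0n// subr_gt0; case/andP: p12.
  have := @gt0_ltr_powR R _ e0 1 b%:R; rewrite powR1 !nnegrE ler01 ler0n.
  by apply => //; rewrite ltr1n.
have [B HB] := level_terms_bounded b2 p12 s1 srho rhob N0 No.
pose S := \prod_(j < k0.+1) s j.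
exists (S + 128 * B) => m; under eq_integral do rewrite chaos_cubeE.
pose c : R := (b%:R ^+ m)^-1 ^+ d.
pose term l : R := (N l)%:R `^ (p0 - 1) *
    (((b%:R ^+ l)^-1 ^+ d) `^ (p0 - 1) * \prod_(j < l.+2) s j).
have term0 l : 0 <= term l.
  rewrite !mulr_ge0 ?powR_ge0//.
  by apply: prodr_ge0 => j _; rewrite (le_trans ler01).
(* S covers the factors of index at most k0. Each later factor, of index l + 1, uses the partition
   of level l and adds 128 * term l, whence the predecessor in the range of the sum. The bound is
   uniform in the points. *)
have discrete (t : {ffun 'I_d -> 'I_(b ^ m)} -> d.-tuple R) :
    (forall h : {ffun 'I_d -> 'I_(b ^ m)}, badic_cube h (t h)) ->
    forall n, (n <= m.+1)%N ->
    (moment P p0 (sampled_mass X t n) <= (S + 128 * \sum_(l < n.-1) term l)%:E)%E.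
  move=> tC; elim=> [_|n IH nm].
    apply: le_trans (moment_sampled_mass_le b0 X_measurable X_indep p12 X_moment tC 0) _.
    rewrite lee_fin /= [X in _ + _ * X]big_ord0 mulr0 addr0; exact: prod_ge1_nd.
  have [nk0|k0n] := leqP n k0.
    apply: le_trans (moment_sampled_mass_le b0 X_measurable X_indep p12 X_moment tC _) _.
    rewrite lee_fin; apply: (@le_trans _ _ S); first exact: prod_ge1_nd.
    by rewrite lerDl mulr_ge0// sumr_ge0.
  case: n IH nm k0n => [//|n] IH nm k0n.
  have [Dcover _] := Dpart n.
  apply: le_trans (moment_sampled_massS b0 X_measurable X_indep X_ge0 X_mean p12
    s1 X_moment tC (l := n) _ Dcover (Dindep n.+1 k0n)) _; first by rewrite ltnW.
  apply: le_trans (leeD2r _ (IH (ltnW nm))) _.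
  by rewrite -EFinD lee_fin /= [X in _ <= _ + _ * X]big_ord_recr/= mulrDr addrA.
apply: (@sampled_moment_le _ _ _ _ _ P (lebesgue_tuple d) p0 p12 (density m)
  (measurable_density m) (density_ge0 m) (density_mean_le m)
  {ffun 'I_d -> 'I_(b ^ m)} (fun h => badic_cube h) (fun=> c)).
- by move=> h; exact: measurable_badic_cube.
- by move=> h; exact: badic_cube_neq0.
- by move=> h; rewrite exprn_ge0// invr_ge0 exprn_ge0.
- by move=> h; exact: lebesgue_badic_cube.
- apply: filterS (ae_unit_cube_ho d) => t ho.
  have [It|It] := pselect (unit_cube d t).
    by left; apply: badic_cube_cover => //; exact: ho.
  by right => w; rewrite density0.
- move=> t tC; have := discrete t tC m.+1 (leqnn _).
  rewrite (_ : (fun w => \sum_h c * density m (w, t h)) = sampled_mass X t m.+1).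
    move=> /le_trans; apply; rewrite lee_fin lerD2l ler_wpM2l//.
  apply/funext => w; apply: eq_bigr => h _; rewrite densityE//.
  by apply/unit_cube_hoS/(badic_cube_sub b0)/tC.
Qed.

End total_mass.

(** * Integrating constants against a density *)

Section density_measure.
Context dT (T : measurableType dT) (R : realType)
  (mu : {measure set T -> \bar R}) (f : T -> \bar R).
Hypotheses (mf : measurable_fun setT f) (f0 : forall x, (0 <= f x)%E).

Let nu (A : set T) : \bar R := (\int[mu]_(x in A) f x)%E.

Let nu0 : nu set0 = 0%E.
Proof. exact: integral_set0. Qed.

Let nu_ge0 A : (0 <= nu A)%E.
Proof. by apply: integral_ge0 => x _; exact: f0. Qed.

Let nu_sigma_additive : semi_sigma_additive nu.
Proof.
move=> /= A mA tA mUA.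
rewrite /nu ge0_integral_bigcup//=; last exact: measurable_funTS.
apply: is_cvg_ereal_nneg_natsum_cond => n _ _.
by apply: integral_ge0 => x _; exact: f0.
Qed.

(** The integral is taken against a bare set function; the rule for constants applies once it is
    packed as a measure. *)
Lemma integral_density_cst1 (D : set T) : measurable D ->
  (\int[fun A => \int[mu]_(x in A) f x]_(x in D) 1 = \int[mu]_(x in D) f x)%E.
Proof.
move=> mD.
pose m : {measure set T -> \bar R} :=
  HB.pack nu (isMeasure.Build _ _ _ nu nu0 nu_ge0 nu_sigma_additive).
by rewrite (integral_cst m mD) mul1e.
Qed.

End density_measure.

(** * A bounded moment excludes convergence to zero *)

Section moment_bounded_limit.
Context dO (Omega : measurableType dO) (R : realType) (P : probability Omega R).
Variables (M : nat -> Omega -> \bar R) (p B : R).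
Hypothesis p1 : 1 < p.
Hypothesis mM : forall m, measurable_fun setT (M m).
Hypothesis M_ge0 : forall m w, (0 <= M m w)%E.
Hypothesis M_mean : forall m, (\int[P]_w M m w = 1)%E.
Hypothesis M_moment : forall m, (\int[P]_w (M m w `^ p) <= B%:E)%E.

(** Above K, x is at most x^p / K^(p-1) because x^(p-1) >= K^(p-1). *)
Let le_truncation (K : R) (x : \bar R) : 0 < K -> (0 <= x)%E ->
  (x <= mine x K%:E + ((K `^ (p - 1))^-1)%:E * x `^ p)%E.
Proof.
move=> K0; case: x => [x| |]//; last first.
  rewrite poweRyr ?gt_eqF// ?(lt_trans ltr01)// => _.
  rewrite gt0_muley ?lte_fin ?invr_gt0 ?powR_gt0// addey//.
rewrite lee_fin poweR_EFin -EFin_min -EFinM -EFinD lee_fin => x0.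
have [xK|/ltW Kx] := leP x K.
  by rewrite lerDl mulr_ge0 ?invr_ge0 ?powR_ge0.
rewrite (@le_trans _ _ ((K `^ (p - 1))^-1 * x `^ p))//; last by rewrite lerDr ltW.
rewrite mulrC ler_pdivlMr ?powR_gt0// -(@mulr_powRB1 _ x p)//; last first.
  exact: lt_trans p1.
rewrite ler_wpM2l// ge0_ler_powR ?nnegrE ?(ltW K0)//.
by rewrite subr_ge0 ltW.
Qed.

(** Truncation at K loses at most B / K^(p-1) of the mean 1, so the truncated masses keep mean at
    least 1/2. Being bounded by K, they would have means tending to 0 by dominated convergence. *)
Lemma moment_bounded_not_ae_cvg0 :
  ~ {ae P, forall w, M m w @[m --> \oo] --> 0%E}.
Proof.
move=> M0.
have B0 : 0 <= B.
  rewrite -lee_fin (le_trans _ (M_moment 0))//.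
  by apply: integral_ge0 => w _; exact: poweR_ge0.
(* Solves K^(p-1) = 2 B + 1, which makes the loss at most 1/2; the 1 keeps the base positive when B
   = 0. *)
pose K := (2 * B + 1) `^ (p - 1)^-1.
have K0 : 0 < K by rewrite powR_gt0//; lra.
have KE : K `^ (p - 1) = 2 * B + 1.
  by rewrite -powRrM mulVf ?powRr1//; [lra|rewrite subr_eq0 gt_eqF].
pose F m w := mine (M m w) K%:E.
have mF m : measurable_fun setT (F m) by apply: measurable_mine.
have F0 m w : (0 <= F m w)%E by rewrite le_min M_ge0 lee_fin ltW.
have half m : (2^-1%:E <= \int[P]_w F m w)%E.
  have mMp : measurable_fun setT (fun w => (M m w `^ p)%E).
    exact: (measurableT_comp (measurable_poweR p)).
  have : (1 <= \int[P]_w F m w + ((K `^ (p - 1))^-1)%:E * B%:E)%E.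
    rewrite -(M_mean m).
    apply: (@le_trans _ _ (\int[P]_w
      (F m w + ((K `^ (p - 1))^-1)%:E * M m w `^ p))%E).
      apply: ge0_le_integral; first exact: measurableT.
      - by move=> w _; exact: M_ge0.
      - exact: mM.
      - by apply: emeasurable_funD => //; exact: measurable_funeM.
      - by move=> w _; exact: le_truncation.
    have V0 : (0 <= ((K `^ (p - 1))^-1)%:E :> \bar R)%E.
      by rewrite lee_fin invr_ge0 powR_ge0.
    rewrite ge0_integralD; first last.
    - exact: measurable_funeM.
    - by move=> w _; rewrite mule_ge0// poweR_ge0.
    - exact: mF.
    - by move=> w _; exact: F0.
    - exact: measurableT.
    rewrite leeD2l// ge0_integralZl//; first exact: lee_wpmul2l.
    by move=> w _; exact: poweR_ge0.
  rewrite KE -EFinM => H.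
  have E : ((2 * B + 1)^-1 * B)%:E = (2^-1 - 2^-1 * (2 * B + 1)^-1)%:E :> \bar R.
    by congr EFin; field; lra.
  have : (((2 * B + 1)^-1 * B)%:E <= 2^-1%:E :> \bar R)%E.
    by rewrite E lee_fin gerBl mulr_ge0// invr_ge0; lra.
  move=> H2; have {H2}H := le_trans H (leeD2l _ H2).
  rewrite -(leeD2rE (x := 2^-1%:E))//; apply: le_trans H.
  by rewrite -EFinD lee_fin; lra.
have FK : {ae P, forall w, [set: Omega] w -> F m w @[m --> \oo] --> 0%E}.
  apply: filterS M0 => w Mw _.
  apply: (@squeeze_cvge _ _ _ _ (cst 0%E) _ (M ^~ w)) => //; last exact: cvg_cst.
  by apply: nearW => m; rewrite F0/= ge_min lexx.
have iK : P.-integrable setT (fun=> K%:E).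
  exact: finite_measure_integrable_cst.
have FK' : {ae P, forall w m, [set: Omega] w -> (`|F m w| <= K%:E)%E}.
  by apply: nearW => w m _; rewrite gee0_abs// ge_min lexx orbT.
have [_ _] := dominated_convergence measurableT mF (measurable_cst _) FK iK FK'.
rewrite integral0 => /cvge_to_ge /(_ (nearW _ half)).
by rewrite lee_fin; apply/negP; rewrite -ltNge invr_gt0.
Qed.

End moment_bounded_limit.

(** * Smaller exponents and the mass of the weak limit *)

Lemma poweR_le1D (R : realType) (p p0 : R) (x : \bar R) :
  0 < p <= p0 -> (0 <= x)%E -> (x `^ p <= 1 + x `^ p0)%E.
Proof.
move=> /andP[pp pp0]; case: x => [x| |]// x0; last first.
  by rewrite poweRyr (gt_eqF, poweRyr)// ?gt_eqF// (lt_le_trans pp).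
rewrite !poweR_EFin -EFinD lee_fin; rewrite lee_fin in x0.
have [x1|/ltW x1] := leP 1 x.
  by rewrite (le_trans (ler_powR x1 pp0))// lerDr.
rewrite (@le_trans _ _ 1)// ?lerDl ?powR_ge0//.
by rewrite -[leRHS](congr1 (@^~ p) (powR1 R)) ge0_ler_powR ?nnegrE// ltW.
Qed.

Lemma chaos_integral_cst1 dO (Omega : measurableType dO) (R : realType) (d : nat)
    (X : nat -> Omega -> d.-tuple R -> R)
    (X_measurable : forall m, jointly_measurable (X m))
    (X_ge0 : forall m w t, unit_cube d t -> 0 <= X m w t) m w :
  (\int[chaos X m w]_(t in unit_cube d) 1 = chaos X m w (unit_cube d))%E.
Proof.
pose f t := (density X m (w, t))%:E.
have mf : measurable_fun setT f.
  apply/measurable_EFinP.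
  exact: (measurableT_comp (measurable_density X_measurable m) (pair1_measurable w)).
have f0 t : (0 <= f t)%E by rewrite lee_fin density_ge0.
have -> : chaos X m w = (fun A => \int[lebesgue_tuple d]_(t in A) f t)%E.
  apply/funext => A; rewrite /chaos [LHS]integral_mkcond [RHS]integral_mkcond.
  apply: eq_integral => t _; rewrite !patchE in_setI /f /density patchE.
  have -> : ((w, t) \in [set: Omega] `*` unit_cube d) = (t \in unit_cube d).
    by rewrite in_setX/= in_setT.
  by case: (t \in A) => //=; case: (t \in unit_cube d).
by apply: integral_density_cst1 => //; exact: measurable_unit_cube.
Qed.

Theorem proposition1 (R : realType) (dO : measure_display)
    (Omega : measurableType dO) (P : probability Omega R)
    (d b : nat) (hd : (1 <= d)%N) (hb : (2 <= b)%N)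
    (X : nat -> Omega -> d.-tuple R -> R)
    (X_measurable : forall m, jointly_measurable (X m))
    (X_indep : independent_processes P X)
    (X_ge0 : forall m w t, unit_cube d t -> 0 <= X m w t)
    (X_mean : forall m t, unit_cube d t -> 'E_P[X m ^~ t]%E = 1%E)
    (p0 : R)
    (A1 : assumption1 P b X)
    (A2 : assumption2 P b X p0) :
  (forall p : R, 1 < p -> p <= p0 ->
     (ereal_sup [set \int[P]_w (chaos X m w (unit_cube d) `^ p) | m in [set: nat]]
        < +oo)%E) /\
  (forall mu : R.-ker Omega ~> d.-tuple R, chaos_limit P X mu ->
     (0 < P [set w | exists A, measurable A /\ mu w A <> 0])%E).
Proof.
have [B HB] := chaos_cube_moment_bounded hd hb X_measurable X_indep X_ge0
  X_mean A1 A2.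
have p01 : 1 < p0 by case: A2 => /andP[].
have mM m := measurable_chaos_cube X_measurable X_ge0 m.
have M0 m w := chaos_cube_ge0 X_ge0 m w.
have mMp p m : measurable_fun setT (fun w => (chaos X m w (unit_cube d) `^ p)%E).
  exact: (measurableT_comp (measurable_poweR p)).
split=> [p p1 pp0|mu [mu_fin mu_cube mu_lim]].
  (* Smaller exponents reduce to p0 through x^p <= 1 + x^p0. *)
  apply: (@le_lt_trans _ _ (1 + B%:E)%E); last by rewrite -EFinD ltry.
  apply: ub_ereal_sup => _ [m _ <-].
  apply: (@le_trans _ _ (\int[P]_w (1 + chaos X m w (unit_cube d) `^ p0))%E).
    apply: ge0_le_integral; first exact: measurableT.
    - by move=> w _; exact: poweR_ge0.
    - exact: mMp.
    - by apply: emeasurable_funD => //; exact: mMp.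
    - by move=> w _; apply: poweR_le1D => //; rewrite pp0 (lt_trans ltr01).
  rewrite ge0_integralD; first last.
  - exact: mMp.
  - by move=> w _; exact: poweR_ge0.
  - exact: measurable_cst.
  - by [].
  - exact: measurableT.
  rewrite integral_cst; last exact: measurableT.
  by rewrite [X in (_ * X + _)%E]probability_setT mule1 leeD2l.
rewrite lt0e measure_ge0 andbT; apply/eqP => PE.
(* A measure is zero exactly when its total mass is; this turns the event into a preimage under a
   measurable function of w. *)
pose E := [set w | mu w [set: d.-tuple R] != 0%E].
have EE : [set w | exists A, measurable A /\ mu w A <> 0%E] = E.
  apply/seteqP; split => w /=; last by move=> /eqP H; exists setT.
  move=> [A [mA muA]]; apply/eqP => muT; apply: muA.
  apply/eqP; rewrite eq_le measure_ge0 andbT -muT.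
  by rewrite le_measure ?inE.
have mE : measurable E.
  have -> : E = mu ^~ [set: d.-tuple R] @^-1` [set~ 0%E].
    by apply/seteqP; split => w /= /eqP.
  rewrite -[X in measurable X]setTI.
  apply: (measurable_kernel mu _ measurableT) => //.
  exact: measurableC (emeasurable_set1 _).
rewrite EE in PE.
apply: (moment_bounded_not_ae_cvg0 p01 mM M0 _ HB).
  by move=> m; exact: chaos_cube_mean.
have aeE : {ae P, forall w, mu w [set: d.-tuple R] = 0%E}.
  by exists E; split => // w /= /eqP.
apply: filterS2 mu_lim aeE => w wlim muT.
(* Testing weak convergence on the constant 1 shows that the total masses tend to the mass of the
   limit, which is almost surely 0 here. *)
have cst1 : @unit_cube_continuous R d (fun=> 1).
  by apply: continuous_subspaceT; exact: cst_continuous.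
have mu0 : mu w (unit_cube d) = 0%E.
  apply/eqP; rewrite eq_le measure_ge0 andbT -muT le_measure ?inE//.
  exact: measurable_unit_cube.
have massE : (fun m => \int[chaos X m w]_(t in unit_cube d) 1)%E =
    (fun m => chaos X m w (unit_cube d)).
  by apply/funext => m; exact: chaos_integral_cst1.
have := wlim _ cst1; rewrite integral_cst; last exact: measurable_unit_cube.
by rewrite massE mu0 mule0.
Qed.
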